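(* Consider the problem of minimizing $F(x)=\mathbb{E}[f_\omega(x)]$ over $x\in\mathbb{X}$ subject to $G^i(x)=\mathbb{E}[g^i_\omega(x)]\le 0$, $i=1,\dots,m$, with optimal value $p^{\mathrm E}_\star$, and suppose the following hold: (a) all subgradients of $F$ and $G^i$ are bounded: $\|\nabla F(x)\|\le C_F$ and $\|\nabla G^i(x)\|\le C_G^i$ for each $i=1,\dots,m$ and all $x\in\mathbb{X}$; (b) $\mathbb{E}\|\nabla f_\omega(x)-\mathbb{E}[\nabla f_\omega(x)]\|^2\le\sigma_F^2$ and $\mathbb{E}\|\nabla g^i_\omega(x)-\mathbb{E}[\nabla g^i_\omega(x)]\|^2\le[\sigma_G^i]^2$ for each $i$ and all $x\in\mathbb{X}$; (c) $\mathbb{E}|g^i_\omega(x)|^2\le[D_G^i]^2$ for each $i$ and all $x\in\mathbb{X}$; (d) the Lagrangian $\mathcal{L}(x,z)=F(x)+z^\top G(x)$ admits a saddle point $(x_\star,z_\star)\in\mathbb{X}\times\mathbb{R}^m_+$. Define $$P_1=2\|x_1-x_\star\|^2+4\|\mathbf{1}+z_\star\|^2,\quad P_2=8(4C_F^2+\sigma_F^2)+2\|D_G\|^2,\quad P_3=8m(4\|C_G\|^2+\|\sigma_G\|^2).$$ Let $\{\gamma_k\}_{k=1}^K$ be a positive sequence with $P_3\sum_{k=1}^K\gamma_k^2<1$. Then the iterates generated by the primal-dual stochastic subgradient method (defined in the context) with step sizes $\gamma_k$ satisfy $$\mathbb{E}[F(\bar{x}_{K+1})]-p^{\mathrm E}_\star\le\frac{1}{4\sum_{k=1}^K\gamma_k}\left(\frac{P_1+P_2\sum_{k=1}^K\gamma_k^2}{1-P_3\sum_{k=1}^K\gamma_k^2}\right),$$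 $$\mathbb{E}[G^i(\bar{x}_{K+1})]\le\frac{1}{4\sum_{k=1}^K\gamma_k}\left(\frac{P_1+P_2\sum_{k=1}^K\gamma_k^2}{1-P_3\sum_{k=1}^K\gamma_k^2}\right),\qquad i=1,\dots,m,$$ where $\bar{x}_{K+1}=\dfrac{\sum_{k=1}^K\gamma_k x_{k+1}}{\sum_{k=1}^K\gamma_k}$. Moreover, if $\gamma_k=\gamma/\sqrt{K}$ for $k=1,\dots,K$ with $0<\gamma<P_3^{-1/2}$, then $$\mathbb{E}[F(\bar{x}_{K+1})]-p^{\mathrm E}_\star\le\frac{\eta}{\sqrt K},\qquad \mathbb{E}[G^i(\bar{x}_{K+1})]\le\frac{\eta}{\sqrt K},\quad i=1,\dots,m,$$ where $\eta=\dfrac{P_1+P_2\gamma^2}{4\gamma(1-P_3\gamma^2)}$.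
   Context: Setting. $\omega\in\Omega$ is random; $\mathbb{X}\subseteq\mathbb{R}^n$ is a closed convex set; the real-valued functions $f_\omega,g^1_\omega,\dots,g^m_\omega$ are convex (not necessarily differentiable) over $\mathbb{X}$, and $\mathbb{E}|f_\omega(x)|$, $\mathbb{E}|g^i_\omega(x)|$ are finite for every $x\in\mathbb{X}$. Write $G=(G^1,\dots,G^m)$, $g_\omega=(g^1_\omega,\dots,g^m_\omega)$, $C_G=(C_G^1,\dots,C_G^m)$, $D_G=(D_G^1,\dots,D_G^m)$, $\sigma_G=(\sigma_G^1,\dots,\sigma_G^m)$. $\|\cdot\|$ is the Euclidean norm, $\mathbf{1}$ is the all-ones vector, $\mathbb{R}_+$ is the set of nonnegative reals. For a convex function $h$, $\nabla h(x)$ denotes a subgradient of $h$ at $x$; in the algorithm the subgradients of $f_\omega$ and $g^i_\omega$ may be arbitrary elements of their subdifferentials, which are assumed nonempty everywhere in $\mathbb{X}$. A point $(x_\star,z_\star)\in\mathbb{X}\times\mathbb{R}^m_+$ is a saddle point of $\mathcal{L}$ if $\mathcal{L}(x_\star,z)\le\mathcal{L}(x_\star,z_\star)\le\mathcal{L}(x,z_\star)$ for all $(x,z)\in\mathbb{X}\times\mathbb{R}^m_+$. Primal-dual stochastic subgradient method. Choose $x_1\in\mathbb{X}$, $z_1=0\in\mathbb{R}^m$ and a positive sequence $(\gamma_k)$. All samples $\omega_1,\omega_{1+1/2},\omega_2,\omega_{2+1/2},\dots$ are independent and identically distributed according to the law of $\omega$. For $k\ge1$: sample $\omega_k$ and set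 $$x_{k+1}=\operatorname*{argmin}_{x\in\mathbb{X}}\Big\langle\nabla f_{\omega_k}(x_k)+\sum_{i=1}^m z_k^i\nabla g^i_{\omega_k}(x_k),\,x-x_k\Big\rangle+\frac{1}{2\gamma_k}\|x-x_k\|^2;$$ then sample $\omega_{k+1/2}$ and set $$z_{k+1}=\operatorname*{argmax}_{z\in\mathbb{R}^m_+}\langle g_{\omega_{k+1/2}}(x_{k+1}),\,z-z_k\rangle-\frac{1}{2\gamma_k}\|z-z_k\|^2.$$ In the conclusions, the expectation is over the samples that generate the iterates. *)

(* Defs.v *)
From HB Require Import structures.
From mathcomp Require Import all_boot all_order all_algebra.
From mathcomp Require Import all_classical all_reals all_analysis.

Set Implicit Arguments.
Unset Strict Implicit.
Unset Printing Implicit Defensive.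

Import Order.TTheory GRing.Theory Num.Theory.
Import numFieldNormedType.Exports.

Local Open Scope classical_set_scope.
Local Open Scope ring_scope.

Definition dotv (R : realType) (n : nat) (u v : 'rV[R]_n) : R :=
  \sum_(j < n) u 0 j * v 0 j.

(* The library norm on matrices is the sup norm, hence this definition. *)
Definition enorm (R : realType) (n : nat) (u : 'rV[R]_n) : R :=
  Num.sqrt (dotv u u).

Definition orthant (R : realType) (m : nat) : set 'rV[R]_m :=
  [set z | forall i, 0 <= z 0 i].

(* R^n with its Borel sigma-algebra. *)
Definition borelV (R : realType) (n : nat) :=
  g_sigma_algebraType (@open 'rV[R]_n).

(* Measurability of h on Om x X, as a function of the pair. *)
Definition jointly_measurable (R : realType) (n : nat) (d d' : measure_display)
    (Om : measurableType d) (S : measurableType d') (X : set 'rV[R]_n)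
    (h : Om -> 'rV[R]_n -> S) : Prop :=
  measurable_fun (setT `*` X : set (Om * borelV R n)) (fun p => h p.1 p.2).

(* Subdifferential at x of a function h considered on the domain D; outside D
   the values of h are irrelevant. D = setT is the usual notion on R^n.  If D
   is a closed convex proper subset of R^n then, at a boundary point of D, the
   subdifferential is stable under adding normal vectors of D, hence
   unbounded as soon as it is nonempty. The function h is extended-valued
   since an expectation may be +oo outside the constraint set. *)
Definition subdifferential (R : realType) (n : nat) (D : set 'rV[R]_n)
    (h : 'rV[R]_n -> \bar R) (x : 'rV[R]_n) : set 'rV[R]_n :=
  [set s | forall y, D y -> (h x + (dotv s (y - x))%:E <= h y)%E].

Definition is_argmin (R : realType) (V : Type) (A : set V) (phi : V -> R)
    (x : V) : Prop :=
  A x /\ forall y, A y -> phi x <= phi y.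

Definition is_argmax (R : realType) (V : Type) (A : set V) (phi : V -> R)
    (x : V) : Prop :=
  A x /\ forall y, A y -> phi y <= phi x.

Section Stochastic.
Context {R : realType} {d : measure_display} {Om : measurableType d}.
Variable mu : probability Om R.

Definition mean {n : nat} (h : Om -> 'rV[R]_n -> R) (x : 'rV[R]_n) : \bar R :=
  'E_mu[fun w => h w x].

(* If a coordinate of v is not integrable, the library integral is infinite
   and fine returns 0. A random vector with finite [variance_vec] always has
   integrable coordinates. *)
Definition mean_vec {n : nat} (v : Om -> 'rV[R]_n) : 'rV[R]_n :=
  \row_(j < n) fine 'E_mu[fun w => v w 0 j].

Definition variance_vec {n : nat} (v : Om -> 'rV[R]_n) : \bar R :=
  'E_mu[fun w => enorm (v w - mean_vec v) ^+ 2].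

End Stochastic.

Section Sampling.
Context {R : realType} {d d' : measure_display}
  {T : measurableType d} {Om : measurableType d'}.

Definition independent_on (P : probability T R) (J : set nat)
    (W : nat -> {RV P >-> Om}) : Prop :=
  forall (s : seq nat) (B : nat -> set Om),
    uniq s -> (forall j, j \in s -> J j) ->
    (forall j, j \in s -> measurable (B j)) ->
    P (\bigcap_(j in [set` s]) (W j @^-1` B j)) =
    (\prod_(j <- s) P (W j @^-1` B j))%E.

Definition iid_on (P : probability T R) (mu : probability Om R) (J : set nat)
    (W : nat -> {RV P >-> Om}) : Prop :=
  independent_on J W /\
  forall j, J j -> forall B, measurable B -> distribution P (W j) B = mu B.

End Sampling.

Section ConstrainedProblem.
Context {R : realType} {n m : nat}.
Variables (X : set 'rV[R]_n) (F : 'rV[R]_n -> \bar R)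
  (G : 'I_m -> 'rV[R]_n -> \bar R).
Local Open Scope ereal_scope.

Definition feasible : set 'rV[R]_n := [set x | X x /\ forall i, G i x <= 0].

Definition optimal_value : \bar R := ereal_inf [set F x | x in feasible].

Definition lagrangian (x : 'rV[R]_n) (z : 'rV[R]_m) : \bar R :=
  F x + \sum_(i < m) (z ord0 i)%:E * G i x.

Definition saddle_point (xs : 'rV[R]_n) (zs : 'rV[R]_m) : Prop :=
  [/\ X xs, orthant zs &
    forall x z, X x -> orthant z ->
      lagrangian xs z <= lagrangian xs zs /\
      lagrangian xs zs <= lagrangian x zs].

End ConstrainedProblem.

(* [W j] is the sample omega_{j/2}: the primal step of iteration k uses
   omega_k = W (k.*2), the dual one omega_{k+1/2} = W k.*2.+1. Iterates are
   indexed from 1; x 0 and z 0 are not used. *)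
Definition primal_dual_iterates (R : realType) (T Om : Type) (n m : nat)
    (X : set 'rV[R]_n) (g : 'I_m -> Om -> 'rV[R]_n -> R)
    (gradf : Om -> 'rV[R]_n -> 'rV[R]_n)
    (gradg : 'I_m -> Om -> 'rV[R]_n -> 'rV[R]_n)
    (gamma : nat -> R) (K : nat) (W : nat -> T -> Om) (x1 : 'rV[R]_n)
    (x : nat -> T -> 'rV[R]_n) (z : nat -> T -> 'rV[R]_m) : Prop :=
  (forall t, x 1%N t = x1 /\ z 1%N t = 0) /\
  forall k t, (1 <= k <= K)%N ->
    is_argmin X
      (fun y => dotv (gradf (W k.*2 t) (x k t) +
                      \sum_(i < m) z k t 0 i *: gradg i (W k.*2 t) (x k t))
                     (y - x k t)
                + (2 * gamma k)^-1 * enorm (y - x k t) ^+ 2)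
      (x k.+1 t) /\
    is_argmax (@orthant R m)
      (fun y => dotv (\row_(i < m) g i (W k.*2.+1 t) (x k.+1 t)) (y - z k t)
                - (2 * gamma k)^-1 * enorm (y - z k t) ^+ 2)
      (z k.+1 t).

(* The weighted average written \bar{x}_{K+1}. *)
Definition averaged_iterate (R : realType) (T : Type) (n : nat)
    (gamma : nat -> R) (K : nat) (x : nat -> T -> 'rV[R]_n) (t : T) :
    'rV[R]_n :=
  (\sum_(1 <= k < K.+1) gamma k)^-1 *:
    \sum_(1 <= k < K.+1) gamma k *: x k.+1 t.

(* Bound b on the expected suboptimality and constraint violation of the random
   point y. The library integral is total, so integrability is what says that
   the two expectations exist. *)
Definition expected_bounds (R : realType) (d : measure_display)
    (T : measurableType d) (P : probability T R) (n m : nat)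
    (X : set 'rV[R]_n) (F : 'rV[R]_n -> \bar R)
    (G : 'I_m -> 'rV[R]_n -> \bar R) (y : T -> 'rV[R]_n) (b : R) : Prop :=
  (P.-integrable setT (fun t => F (y t)) /\
   (\int[P]_t F (y t) - optimal_value X F G <= b%:E)%E) /\
  forall i, P.-integrable setT (fun t => G i (y t)) /\
    (\int[P]_t G i (y t) <= b%:E)%E.

(* Main.v *)
(** The iterates are functions of the samples drawn before, hence independent of
    the next sample, which can be integrated out with the iterates frozen; the
    sampling noise thus has mean zero against the past.  Adding the three-point
    inequalities of the primal and dual steps, taking expectations and absorbing
    the displacement [x_{k+1} - x_k] by Young's inequality gives, for every
    deterministic [u >= 0] and with [p] the optimal value,
      [4 gamma_k (E L(x_{k+1}, u) - p)
         <= 2 (a_k - a_{k+1}) + gamma_k^2 (P2 + P3 E|z_k|^2)],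
    where [a_k = E|x_k - xs|^2 + E|z_k - u|^2].  With [u = zs] the left-hand
    side is nonnegative and the recursion bounds [max_k E|z_k|^2] by
    [(P1 + P2 S2) / (1 - P3 S2)], with [S2] the sum of the [gamma_k^2].  The
    choices [u = 0] and [u = zs + e_i], together with Jensen's inequality, then
    give the bounds on the objective and on the i-th constraint. *)
Require Import Defs.
From HB Require Import structures.
From mathcomp Require Import all_boot all_order all_algebra.
From mathcomp Require Import all_classical all_reals all_analysis.
From mathcomp Require Import measurable_realfun.
From mathcomp Require Import ring lra.

Set Implicit Arguments.
Unset Strict Implicit.
Unset Printing Implicit Defensive.

Import Order.TTheory GRing.Theory Num.Theory.
Import numFieldNormedType.Exports.

Local Open Scope classical_set_scope.
Local Open Scope ring_scope.

(** * Euclidean geometry and proximal steps *)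

(** Neither measurability nor finite moments of the iterates are assumed: [x] and [z] are tied to
    the samples only by the argmin and argmax relations. Both properties are carried by induction in
    [regular_iterate]. A proximal step is the projection of a measurable vector and is 1-Lipschitz
    in it, which transports measurability with respect to the past samples and square integrability
    to the next iterate. In the same way bounded subgradients make the means of f and g^i Lipschitz
    on X, so that their values at random points are measurable and square integrable. Since x_{k+1}
    depends on omega_k, the primal noise is tested against x_k - xs, which is known before the draw.
    The multipliers amplify the noise of the constraint subgradients, so |z_k|^2 reappears on the
    right-hand side; the condition P3 S2 < 1 closes this feedback. *)

Section Euclidean.
Context {R : realType} {n : nat}.
Implicit Types u v w x y p : 'rV[R]_n.

Lemma dotvC u v : dotv u v = dotv v u.
Proof. by apply: eq_bigr => j _; rewrite mulrC. Qed.

Lemma dotvDl u v w : dotv (u + v) w = dotv u w + dotv v w.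
Proof. by rewrite -big_split; apply: eq_bigr => j _; rewrite !mxE mulrDl. Qed.

Lemma dotvZl a u v : dotv (a *: u) v = a * dotv u v.
Proof. by rewrite mulr_sumr; apply: eq_bigr => j _; rewrite !mxE mulrA. Qed.

Lemma dotvDr u v w : dotv w (u + v) = dotv w u + dotv w v.
Proof. by rewrite dotvC dotvDl !(dotvC w). Qed.

Lemma dotvZr a u v : dotv u (a *: v) = a * dotv u v.
Proof. by rewrite dotvC dotvZl dotvC. Qed.

Lemma dotvNl u v : dotv (- u) v = - dotv u v.
Proof. by rewrite -scaleN1r dotvZl mulN1r. Qed.

Lemma dotvNr u v : dotv u (- v) = - dotv u v.
Proof. by rewrite dotvC dotvNl dotvC. Qed.

Definition dotvE := (dotvDl, dotvDr, dotvNl, dotvNr, dotvZl, dotvZr).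

Lemma dotv0r u : dotv u 0 = 0.
Proof. by rewrite -(scale0r u) dotvZr mul0r. Qed.

Lemma dotv_suml (I : Type) (r : seq I) (s : I -> 'rV[R]_n) v :
  dotv (\sum_(i <- r) s i) v = \sum_(i <- r) dotv (s i) v.
Proof.
elim: r => [|i r IH]; first by rewrite !big_nil dotvC dotv0r.
by rewrite !big_cons dotvDl IH.
Qed.

Lemma dotv_ge0 u : 0 <= dotv u u.
Proof. by apply: sumr_ge0 => j _; rewrite -expr2 sqr_ge0. Qed.

Lemma enorm_sqr u : enorm u ^+ 2 = dotv u u.
Proof. by rewrite sqr_sqrtr// dotv_ge0. Qed.

Lemma dotv_young u v : 2 * dotv u v <= dotv u u + dotv v v.
Proof.
by have := dotv_ge0 (u - v); rewrite !dotvE (dotvC v u); lra.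
Qed.

Lemma dotvD_le u v :
  dotv (u + v) (u + v) <= 2 * dotv u u + 2 * dotv v v.
Proof.
by have := dotv_ge0 (u - v); rewrite !dotvE (dotvC v u); lra.
Qed.

Lemma sqr_coord_le_dotv u j : u 0 j ^+ 2 <= dotv u u.
Proof.
rewrite /dotv (bigD1 j)//= -expr2 lerDl; apply: sumr_ge0 => i _.
by rewrite -expr2 sqr_ge0.
Qed.

(** Comparing [p] with the point at parameter t on the segment towards [y] gives -t q <= l, where l
    is 2c times the directional derivative of the objective at [p]. Letting t tend to 0 yields l >=
    0, which is the claim after expanding the squares. *)
Lemma prox_three_point (A : set 'rV[R]_n) v x p (c : R) :
  (forall y z (t : R), A y -> A z -> 0 <= t <= 1 ->
     A (t *: y + (1 - t) *: z)) ->
  0 < c ->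
  is_argmin A (fun y => dotv v (y - x) + (2 * c)^-1 * enorm (y - x) ^+ 2) p ->
  forall y, A y ->
    2 * c * dotv v (p - y) <=
      dotv (y - x) (y - x) - dotv (y - p) (y - p) - dotv (p - x) (p - x).
Proof.
move=> cA c0 [Ap pmin] y Ay.
set q := dotv (y - p) (y - p).
set l := 2 * c * dotv v (y - p) + 2 * dotv (p - x) (y - p).
suff l0 : 0 <= l.
  rewrite -subr_ge0 (_ : _ - _ = l)// /l.
  by rewrite /q !dotvE (dotvC p y) (dotvC p x) (dotvC x y); ring.
have lq (t : R) : 0 < t <= 1 -> - t * q <= l.
  move=> /andP[t0 t1].
  have := pmin _ (cA y p t Ay Ap _); rewrite t1 (ltW t0) => /(_ isT).
  rewrite (_ : t *: y + (1 - t) *: p = p + t *: (y - p)); last first.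
    by rewrite scalerBr scalerBl scale1r addrCA addrA.
  rewrite !enorm_sqr -(ler_pM2l (_ : 0 < 2 * c)) ?mulr_gt0// !mulrDr.
  rewrite !mulrA !mulfV ?mul1r ?mulf_neq0 ?lt0r_neq0// -subr_ge0.
  rewrite (_ : _ - _ = t * (l + t * q)); last first.
    by rewrite /l /q !dotvE (dotvC p y) (dotvC p x) (dotvC x y); ring.
  by rewrite pmulr_rge0//; lra.
have q0 : 0 <= q := dotv_ge0 _.
rewrite leNgt; apply/negP => l0.
have [tl|tl] := leP (- l) (q + 1); last first.
  by have := lq 1; rewrite ltr01 lexx => /(_ isT); lra.
(* If l < 0, this t turns -t q <= l into 0 <= l / (q + 1), a contradiction; t <= 1 by the case
   distinction. *)
have := lq (- l / (q + 1)).
have qp : 0 < q + 1 by lra.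
rewrite ler_pdivrMr// mul1r tl divr_gt0 ?oppr_gt0// => /(_ isT).
rewrite mulNr -subr_ge0 (_ : _ - _ = l / (q + 1)).
  by rewrite pmulr_lge0 ?invr_gt0//; lra.
by field; rewrite lt0r_neq0.
Qed.

(** [p] is the projection of x - c v on A: each minimizer is the competitor in the three-point
    inequality of the other, and Young's inequality finishes. This gives both the measurability of
    the iterates and, by comparison with a step that stays put, their second moments. *)
Lemma prox_nonexpansive (A : set 'rV[R]_n) v v' x x' p p' (c : R) :
  (forall y z (t : R), A y -> A z -> 0 <= t <= 1 ->
     A (t *: y + (1 - t) *: z)) ->
  0 < c ->
  is_argmin A (fun y => dotv v (y - x) + (2 * c)^-1 * enorm (y - x) ^+ 2) p ->
  is_argmin A (fun y => dotv v' (y - x') + (2 * c)^-1 * enorm (y - x') ^+ 2)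
    p' ->
  dotv (p - p') (p - p') <=
    dotv ((x - c *: v) - (x' - c *: v')) ((x - c *: v) - (x' - c *: v')).
Proof.
move=> cA c0 pm pm'.
have := prox_three_point cA c0 pm (proj1 pm').
have := prox_three_point cA c0 pm' (proj1 pm).
have := dotv_young (p - p') ((x - c *: v) - (x' - c *: v')).
rewrite !dotvE.
rewrite ?(dotvC p' p) ?(dotvC x p) ?(dotvC x p') ?(dotvC x' p) ?(dotvC x' p').
rewrite ?(dotvC v p) ?(dotvC v p') ?(dotvC v' p) ?(dotvC v' p') ?(dotvC x' x).
rewrite ?(dotvC v x) ?(dotvC v x') ?(dotvC v' x) ?(dotvC v' x') ?(dotvC v' v).
by lra.
Qed.

End Euclidean.

(** Lagrange's identity: the double sum of (a_i b_j - a_j b_i)^2 is twice the difference of the two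
    sides. *)
Lemma cauchy_sum (R : realType) (I : finType) (a b : I -> R) :
  (\sum_i a i * b i) ^+ 2 <= (\sum_i a i ^+ 2) * (\sum_i b i ^+ 2).
Proof.
have e1 : \sum_i \sum_j a i ^+ 2 * b j ^+ 2 =
    (\sum_i a i ^+ 2) * (\sum_i b i ^+ 2) by rewrite big_distrlr.
have e2 : \sum_i \sum_j a j ^+ 2 * b i ^+ 2 =
    (\sum_i a i ^+ 2) * (\sum_i b i ^+ 2) by rewrite exchange_big.
have e3 : \sum_i \sum_j (a i * b i) * (a j * b j) = (\sum_i a i * b i) ^+ 2.
  by rewrite expr2 big_distrlr.
have : 0 <= \sum_i \sum_j (a i * b j - a j * b i) ^+ 2.
  by apply: sumr_ge0 => i _; apply: sumr_ge0 => j _; rewrite sqr_ge0.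
rewrite (_ : \sum_i _ = \sum_i \sum_j a i ^+ 2 * b j ^+ 2
    + \sum_i \sum_j a j ^+ 2 * b i ^+ 2
    - 2 * \sum_i \sum_j (a i * b i) * (a j * b j)); last first.
  rewrite mulr_sumr -big_split -sumrB; apply: eq_bigr => i _ /=.
  rewrite mulr_sumr -big_split -sumrB; apply: eq_bigr => j _ /=.
  by ring.
by rewrite e1 e2 e3; lra.
Qed.

Lemma dotv_sumZ_le (R : realType) (n m : nat) (z : 'rV[R]_m)
    (s : 'I_m -> 'rV[R]_n) :
  dotv (\sum_i z 0 i *: s i) (\sum_i z 0 i *: s i) <= dotv z z * \sum_i dotv (s
    i) (s i).
Proof.
rewrite /dotv exchange_big mulr_sumr/=.
apply: ler_sum => j _; have -> : (\sum_i z 0 i *: s i) 0 j = \sum_i z 0 i * s i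
  0 j.
  by rewrite summxE; apply: eq_bigr => i _; rewrite mxE.
exact: cauchy_sum.
Qed.

Lemma convex_setE (R : realType) (n : nat) (X : set 'rV[R]_n) :
  convex_set X -> forall y z (t : R), X y -> X z -> 0 <= t <= 1 ->
    X (t *: y + (1 - t) *: z).
Proof.
move=> cX y z t Xy Xz t01.
have [t0 t1] := andP t01.
have := cX y z (Itv01 t0 t1); rewrite !inE => /(_ Xy Xz).
by rewrite /conv/=.
Qed.

Lemma orthant_convex (R : realType) (m : nat) (y z : 'rV[R]_m) (t : R) :
  orthant y -> orthant z -> 0 <= t <= 1 ->
  orthant (t *: y + (1 - t) *: z).
Proof.
move=> y0 z0 /andP[t0 t1] i; rewrite !mxE addr_ge0 ?mulr_ge0 ?subr_ge0//.
Qed.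

Lemma orthant_argmax_min (R : realType) (m : nat) (v x p : 'rV[R]_m) (b : R) :
  is_argmax (@orthant R m) (fun y => dotv v (y - x) - b * enorm (y - x) ^+ 2) p
  -> is_argmin (@orthant R m)
       (fun y => dotv (- v) (y - x) + b * enorm (y - x) ^+ 2) p.
Proof.
move=> [Ap pmax]; split=> // y /pmax.
by rewrite -lerN2 !opprB !dotvNl ![- _ + _]addrC.
Qed.

(** * Borel measurability of random vectors *)

(* [Z] is a function of [Y], uniformly continuous on the range of [Y]: this
   makes an argmin measurable without constructing the minimizing map on the
   whole space. *)
Lemma borel_vector_modulus (R : realType) (p q : nat) (d : measure_display)
    (T : measurableType d) (Y : T -> borelV R p) (Z : T -> borelV R q) :
  measurable_fun setT Y ->
  (forall e : R, 0 < e -> exists2 r : R, 0 < r &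
     forall t t', ball (Y t : 'rV[R]_p) r (Y t') ->
                  ball (Z t : 'rV[R]_q) e (Z t')) ->
  measurable_fun setT Z.
Proof.
move=> mY YZ.
apply: (@measurability _ _ T (borelV R q) setT _ (@open 'rV[R]_q) erefl).
move=> _ [U oU <-]; rewrite setTI.
pose V : set 'rV[R]_p :=
  [set y | \forall y' \near y, forall t, Y t = y' -> U (Z t)]°.
have -> : Z @^-1` U = Y @^-1` V.
  apply/seteqP; split => t /=.
    move=> UZ.
    have /nbhs_ballP[e/= e0 eU] : nbhs (Z t : 'rV[R]_q) U.
      exact: open_nbhs_nbhs.
    have [r r0 rYZ] := YZ e e0.
    have : \forall y \near (Y t : 'rV[R]_p), forall t, Y t = y -> U (Z t).
      apply/nbhs_ballP; exists r => //= y byt t' Yt'.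
      by apply/eU/rYZ; rewrite Yt'.
    by move/nbhs_interior/nbhs_interior/nbhs_singleton.
  by move=> /interior_subset /nbhs_singleton; exact.
rewrite -[X in measurable X]setTI; apply: mY => //.
by apply: sub_sigma_algebra; exact: open_interior.
Qed.

Lemma borel_coord_measurable (R : realType) (n : nat) (j : 'I_n) :
  measurable_fun setT (fun y : borelV R n => (y : 'rV[R]_n) 0 j).
Proof.
apply: (measurability _ (measurable_realfun.RGenOpens.measurableE R)) => _ [_
  [a [b ->]] <-].
rewrite setTI; apply: sub_sigma_algebra.
apply: (@open_comp _ _ (fun y : 'rV[R]_n => y 0 j)); last exact: interval_open.
by move=> y _; exact: coord_continuous.
Qed.

(** An open set is the union of the countably many boxes with rational centre and radius 1/(k+1)
    that it contains, and the preimage of a box is a finite intersection of conditions on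
    coordinates. *)
Lemma borel_vector_measurable (R : realType) (n : nat) (d : measure_display)
    (T : measurableType d) (Y : T -> borelV R n) :
  (forall j, measurable_fun setT (fun t => (Y t : 'rV[R]_n) 0 j)) ->
  measurable_fun setT Y.
Proof.
move=> mY; apply: (@measurability _ _ T (borelV R n) setT _ (@open 'rV[R]_n)
  erefl).
move=> _ [U oU <-]; rewrite setTI.
pose c (a : 'rV[rat]_n * nat) : 'rV[R]_n := map_mx ratr a.1.
pose B a : set 'rV[R]_n := [set y | forall j, `|c a 0 j - y 0 j| <
  a.2.+1%:R^-1].
have -> : Y @^-1` U =
  \bigcup_(a in [set a | B a `<=` U]) \bigcap_(j in [set: 'I_n])
     [set t | `|c a 0 j - (Y t : 'rV[R]_n) 0 j| < a.2.+1%:R^-1].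
  apply/seteqP; split => t /=; last first.
    by move=> [a/= BU Yt]; apply: BU => j; exact: Yt.
  move=> UY.
  have /nbhs_ballP[e/= e0 eU] : nbhs (Y t : 'rV[R]_n) U by exact:
    open_nbhs_nbhs.
  (* The rational centre is within one radius of [Y t], so the whole box lies within two radii, less
     than e, of [Y t]. *)
  have [k ke] : exists k, k.+1%:R^-1 < e / 2.
    by have [k] := ltr_add_invr (divr_gt0 e0 (ltr0n R 2)); rewrite add0r;
      exists k.
  have k0 : 0 < k.+1%:R^-1 :> R by rewrite invr_gt0.
  have /choice[q qP] : forall j, exists q : rat,
      ratr q \in `](Y t : 'rV[R]_n) 0 j - k.+1%:R^-1, (Y t : 'rV[R]_n) 0 j +
        k.+1%:R^-1[.
    by move=> j; apply: rat_in_itvoo; rewrite ltrBlDr -addrA ltrDl addr_gt0.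
  exists (\row_j q j, k).
    move=> y yB; apply: eU; split=> // i j; rewrite ord1 /ball/=.
    have := yB j; have := qP j; rewrite /c !mxE/= in_itv/= !ltr_norml.
    move: ke k0; move: (k.+1%:R^-1) (ratr _) (y 0 j) (_ 0 j) => r a b b'.
    by move=> ? ? /andP[? ?] /andP[? ?]; apply/andP; split; lra.
  move=> j _ /=; rewrite /c !mxE ltr_norml.
  have := qP j; rewrite in_itv/=.
  move: (k.+1%:R^-1) (ratr _) ((Y t : 'rV[R]_n) 0 j) => r a b.
  by move=> /andP[? ?]; apply/andP; split; lra.
rewrite bigcup_mkcond.
pose F a := if a \in [set a | B a `<=` U] then \bigcap_(j in [set: 'I_n])
     [set t | `|c a 0 j - (Y t : 'rV[R]_n) 0 j| < a.2.+1%:R^-1] else set0.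
rewrite (_ : \bigcup_a _ = \bigcup_k (if unpickle k is Some a then F a else
  set0)).
  apply: bigcupT_measurable => k; case: unpickle => // a.
  rewrite /F; case: ifPn => // _; apply: fin_bigcap_measurable => // j _.
  have mcY : measurable_fun setT (fun t => `|c a 0 j - (Y t : 'rV[R]_n) 0 j|).
    by apply: measurableT_comp => //; exact: measurable_funB.
  have := mcY measurableT _ (measurable_itv `]-oo, a.2.+1%:R^-1[).
  by rewrite setTI preimage_itvNyo.
apply/seteqP; split => [t [a _ Ft]|t [k _]].
  by exists (pickle a) => //; rewrite pickleK.
by case: unpickle => // a Ft; exists a.
Qed.

(** * History of the samples and freezing *)

Section History.
Context {R : realType} {d d' : measure_display}
  {T : measurableType d} {Om : measurableType d'}.
Variables (P : probability T R) (mu : probability Om R)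
  (W : nat -> {RV P >-> Om}).
Hypothesis iidW : iid_on mu [set j | (2 <= j)%N] W.

(* A pi-system generating the sigma-algebra of the samples W i, 2 <= i < j. *)
Definition past (j : nat) : set (set T) :=
  [set A | exists B : nat -> set Om, (forall i, measurable (B i)) /\
     A = \bigcap_(i in [set` iota 2 (j - 2)]) (W i @^-1` B i)].

Local Notation hist j := (g_sigma_algebraType (past j)).

Lemma RV_preimage i (B : set Om) : measurable B -> measurable (W i @^-1` B).
Proof. by move=> mB; rewrite -[X in measurable X]setTI; exact: measurable_funP.
  Qed.

Lemma past_measurable j : past j `<=` measurable.
Proof.
move=> _ [B [mB ->]]; apply: fin_bigcap_measurable => // i _.
exact: RV_preimage.
Qed.

Lemma past_setI j : setI_closed (past j).
Proof.
move=> _ _ [B [mB ->]] [C [mC ->]]; exists (fun i => B i `&` C i); split.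
  by move=> i; exact: measurableI.
by rewrite -bigcapI; apply: eq_bigcapr => i _; rewrite preimage_setI.
Qed.

Lemma past_setT j : past j setT.
Proof.
exists (fun=> setT); split => //.
by apply/esym/seteqP; split => // t _ i _.
Qed.

Lemma past_mono j j' : (j <= j')%N -> past j `<=` past j'.
Proof.
move=> jj' _ [B [mB ->]].
exists (fun i => if i \in iota 2 (j - 2) then B i else setT); split.
  by move=> i; case: ifP.
apply/seteqP; split => t Bt i /= ij'; first by case: ifPn => // /Bt.
have := Bt i; rewrite /= ij'; apply => //=.
move: ij'; rewrite !mem_iota => /andP[-> /=] h; apply: leq_trans h _.
by rewrite leq_add2l leq_sub2r.
Qed.

Lemma hist_measurable j (A : set T) :
  measurable (A : set (hist j)) -> measurable A.
Proof.
apply: smallest_sub; first exact: sigma_algebra_measurable.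
exact: past_measurable.
Qed.

Lemma hist_le j j' (A : set T) : (j <= j')%N ->
  measurable (A : set (hist j)) -> measurable (A : set (hist j')).
Proof. by move=> jj'; apply: sub_smallest2r => //; exact: past_mono. Qed.

Lemma hist_fun d1 (S : measurableType d1) j (Y : T -> S) :
  measurable_fun setT (Y : hist j -> S) -> measurable_fun setT Y.
Proof. by move=> mY _ B mB; apply: (@hist_measurable j); exact: mY. Qed.

Lemma hist_fun_le d1 (S : measurableType d1) j j' (Y : T -> S) :
  (j <= j')%N ->
  measurable_fun setT (Y : hist j -> S) ->
  measurable_fun setT (Y : hist j' -> S).
Proof. by move=> jj' mY _ B mB; apply: hist_le jj' _; exact: mY. Qed.

Lemma hist_sample i j : (2 <= i < j)%N ->
  measurable_fun setT (W i : hist j -> Om).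
Proof.
move=> /andP[i2 ij] _ B mB; rewrite setTI; apply: sub_sigma_algebra.
exists (fun k => if k == i then B else setT); split.
  by move=> k; case: ifP.
apply/seteqP; split => t /=.
  by move=> Bt k _ /=; case: eqP => // ->.
by move=> /(_ i); rewrite /= eqxx; apply; rewrite /= mem_iota i2 subnKC//
  (leq_trans i2)// ltnW.
Qed.

(** Both sides are finite measures in [A]: a restriction of P on the left, a multiple of P on the
    right. They agree on the pi-system [past W j] by independence, hence on the sigma-algebra it
    generates. *)
Lemma hist_indep j (A : set T) (B : set Om) : (2 <= j)%N ->
  measurable (A : set (hist j)) -> measurable B ->
  P (A `&` W j @^-1` B) = (P A * mu B)%E.
Proof.
move=> j2 mA mB; have [indep law] := iidW.
have mWB : measurable (W j @^-1` B) by exact: RV_preimage.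
have k0 : 0 <= fine (mu B) by rewrite fine_ge0.
pose k : {nonneg R} := NngNum k0.
have kE : k%:num%:E = mu B by rewrite fineK// fin_num_measure.
rewrite -[LHS]/(mrestr P mWB A) muleC -kE -[RHS]/(mscale k P A).
apply: (g_sigma_algebra_measure_unique (past j) _ (fun=> setT)) => //.
- exact: past_measurable.
- by move=> _; exact: past_setT.
- by rewrite bigcup_const.
- exact: past_setI.
- move=> _ [C [mC ->]]; rewrite -[LHS]/(P (_ `&` _)) -[RHS]/(k%:num%:E * P _)%E
  kE.
  set s := iota 2 (j - 2).
  have js i : i \in s -> (i < j)%N.
    by rewrite mem_iota subnKC// => /andP[].
  (* With [B] placed in slot j, the joint event becomes one product event over the list [j :: s]. *)
  pose C' i := if i == j then B else C i.
  have mC' i : measurable (C' i) by rewrite /C'; case: ifP.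
  have CC' i : i \in s -> C' i = C i.
    by move=> /js ij; rewrite /C' ltn_eqF.
  transitivity (P (\bigcap_(i in [set` j :: s]) (W i @^-1` C' i))).
    congr (P _); apply/seteqP; split => [t [Ct Bt] i /=|t Ct].
      rewrite inE => /predU1P[->|si]; first by rewrite /C' eqxx.
      by rewrite CC'//; exact: Ct.
    split; last by have := Ct j; rewrite /= /C' eqxx; apply; rewrite inE eqxx.
    by move=> i /= si; rewrite -CC'//; apply: Ct; rewrite /= inE si orbT.
  rewrite indep.
  + rewrite big_cons [in LHS]/C' eqxx -[P (_ @^-1` B)]/(distribution P (W j) B).
    rewrite law//; congr (_ * _)%E.
    rewrite indep; last 3 first.
    * exact: iota_uniq.
    * by move=> i /=; rewrite mem_iota => /andP[].
    * by move=> i _; exact: mC.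
    by apply: eq_big_seq => i si; congr (P (_ @^-1` _)); exact: CC'.
  + rewrite /= iota_uniq andbT; apply/negP => /js.
    by rewrite ltnn.
  + by move=> i; rewrite inE => /predU1P[->//|] /=; rewrite mem_iota => /andP[].
  + by move=> i _; exact: mC'.
- move=> _; apply: (@le_lt_trans _ _ 1%E); last exact: ltry.
  by rewrite [leLHS]/= /mrestr setTI probability_le1.
Qed.

Section freezing.
Variables (j : nat) (j2 : (2 <= j)%N).

(** The identity into the coarser sigma-algebra: its distribution is P restricted to the history,
    the first factor of the product law of the pair (history, [W j]). *)
Let idh : T -> hist j := idfun.
Let midh : measurable_fun setT idh.
Proof. by move=> _ B mB; rewrite setTI; exact: (@hist_measurable j). Qed.
HB.instance Definition _ := isMeasurableFun.Build _ _ _ _ idh midh.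

Let pairh (t : T) : hist j * Om := (t, W j t).
Let mpairh : measurable_fun setT pairh.
Proof. by apply: measurable_fun_pair => //; exact: midh. Qed.
HB.instance Definition _ := isMeasurableFun.Build _ _ _ _ pairh mpairh.

Let law_pair A : measurable A ->
  (distribution P idh \x mu)%E A = distribution P pairh A.
Proof.
move=> mA; apply: product_measure_unique => // B C mB mC.
exact: (hist_indep j2 mB mC).
Qed.

Local Open Scope ereal_scope.
Variable H : hist j * Om -> \bar R.
Hypothesis mH : measurable_fun setT H.

(* The sample W j is independent of the history, so conditionally on the
   latter it can be integrated out with the history frozen. *)
Lemma ge0_freezing : (forall p, 0 <= H p) ->
  \int[P]_t H (t, W j t) = \int[P]_t \int[mu]_w H (t, w).
Proof.
move=> H0.
rewrite -[LHS](@ge0_integral_distribution _ _ _ _ _ P pairh H)//.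
rewrite (eq_measure_integral (distribution P idh \x mu)); last first.
  by move=> A mA _; apply/esym/law_pair.
rewrite fubini_tonelli1// /fubini_F ge0_integral_distribution//.
  exact: measurable_fun_fubini_tonelli_F.
by move=> t; apply: integral_ge0.
Qed.

(** Fubini replaces Tonelli; integrability is carried to the product law by change of variables. *)
Lemma freezing : P.-integrable setT (fun t => H (t, W j t)) ->
  \int[P]_t H (t, W j t) = \int[P]_t \int[mu]_w H (t, w).
Proof.
move=> iH.
have iH' : (distribution P idh \x mu).-integrable setT H.
  apply/integrableP; split => //.
  rewrite (eq_measure_integral (distribution P pairh)); last first.
    by move=> A mA _; exact: law_pair.
  rewrite ge0_integral_distribution//; last exact: measurableT_comp.
  by move/integrableP : iH => [].
rewrite -[LHS](@integral_distribution _ _ _ _ _ P pairh H)//.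
rewrite (eq_measure_integral (distribution P idh \x mu)); last first.
  by move=> A mA _; apply/esym/law_pair.
rewrite -integral12_prod_meas1// integral_distribution//.
  exact: measurable_fubini_F iH'.
have /integrableP[mF iF] := integrable_fubini_F iH'.
apply/integrableP; split.
  exact: measurableT_comp mF midh.
move: iF; rewrite ge0_integral_distribution//; exact: measurableT_comp.
Qed.

End freezing.
End History.

(** * Integrals of real random variables *)

Section RealIntegral.
Context {R : realType} {d : measure_display} {T : measurableType d}.
Variable P : probability T R.
Implicit Types h k : T -> R.

Definition intg h := P.-integrable setT (EFin \o h).

Lemma intg_measurable h : intg h -> measurable_fun setT h.
Proof. by case/integrableP => /measurable_EFinP. Qed.

Lemma intg_le h k : measurable_fun setT h -> (forall t, `|h t| <= k t) ->
  intg k -> intg h.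
Proof.
move=> mh hk; apply: le_integrable => //; first exact/measurable_EFinP.
by move=> t _ /=; rewrite lee_fin (le_trans (hk t))// ler_norm.
Qed.

Lemma intg_cst (c : R) : intg (fun=> c).
Proof. exact: finite_measure_integrable_cst. Qed.

Lemma intgD h k : intg h -> intg k -> intg (fun t => h t + k t).
Proof. by move=> ih ik; exact: integrableD ih ik. Qed.

Lemma intgZ (c : R) h : intg h -> intg (fun t => c * h t).
Proof. by move=> ih; exact: integrableZl ih. Qed.

Lemma intgN h : intg h -> intg (fun t => - h t).
Proof. by move=> ih; exact: integrableN ih. Qed.

Lemma intgB h k : intg h -> intg k -> intg (fun t => h t - k t).
Proof. by move=> ih /intgN; exact: intgD. Qed.

Lemma intg_sum (I : Type) (r : seq I) (h : I -> T -> R) :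
  (forall i, intg (h i)) -> intg (fun t => \sum_(i <- r) h i t).
Proof.
move=> ih; elim: r => [|i r IH].
  by under eq_fun do rewrite big_nil; exact: intg_cst.
by under eq_fun do rewrite big_cons; exact: intgD.
Qed.

Lemma intgM h k : measurable_fun setT h -> measurable_fun setT k ->
  intg (fun t => h t ^+ 2) -> intg (fun t => k t ^+ 2) ->
  intg (fun t => h t * k t).
Proof.
move=> mh mk ih ik.
apply: (intg_le _ _ (intgD ih ik)); first exact: measurable_funM.
move=> t; rewrite ler_norml; apply/andP; split.
  by have := sqr_ge0 (h t + k t); have := sqr_ge0 (h t); have := sqr_ge0 (k t);
    nra.
by have := sqr_ge0 (h t - k t); have := sqr_ge0 (h t); have := sqr_ge0 (k t);
  nra.
Qed.

Lemma intg_sqr h : measurable_fun setT h -> intg (fun t => h t ^+ 2) -> intg h.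
Proof.
move=> mh ih; have := intgM mh (@measurable_cst _ _ T R setT 1) ih (intg_cst (1
  ^+ 2)).
by under eq_fun do rewrite mulr1.
Qed.

Lemma intg_Rintegral h : intg h -> (\int[P]_t (h t)%:E)%E = (\int[P]_t h t)%:E.
Proof. by move=> ih; rewrite fineK// integrable_fin_num. Qed.

Lemma Rintegral_sum (I : Type) (r : seq I) (h : I -> T -> R) :
  (forall i, intg (h i)) ->
  \int[P]_t (\sum_(i <- r) h i t) = \sum_(i <- r) \int[P]_t h i t.
Proof.
move=> ih; elim: r => [|i r IH].
  rewrite big_nil -[RHS](mul0r (fine (P setT))) -Rintegral_cst//.
  by apply: eq_Rintegral => t _; rewrite big_nil.
rewrite big_cons -IH -RintegralD//; [|exact: ih|exact: intg_sum].
by apply: eq_Rintegral => t _; rewrite big_cons.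
Qed.

Lemma Rintegral_prob_cst (c : R) : \int[P]_(t in setT) c = c.
Proof.
rewrite Rintegral_cst// (_ : fine _ = 1) ?mulr1//.
by rewrite [X in fine X](_ : _ = 1%E)//; exact: probability_setT.
Qed.

Lemma intg_bound h (c : R) : measurable_fun setT h -> (forall t, 0 <= h t) ->
  (\int[P]_t (h t)%:E <= c%:E)%E -> intg h.
Proof.
move=> mh h0 hc; apply/integrableP; split; first exact/measurable_EFinP.
rewrite (le_lt_trans _ (ltry c))//; apply: le_trans hc.
by under eq_integral => t _ do rewrite /= ger0_norm//.
Qed.

(* The mean of [f] may be [+oo] outside the constraint set. *)
Lemma le_integral_minorant (h k : T -> \bar R) :
  P.-integrable setT h -> measurable_fun setT k -> (forall t, h t <= k t)%E ->
  (\int[P]_t h t <= \int[P]_t k t)%E.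
Proof.
move=> /measurable_int mh mk hk; rewrite integralE [leRHS]integralE.
apply: leeB; apply: ge0_le_integral => //.
- exact: measurable_funepos.
- exact: measurable_funepos.
- by move=> t _; apply: (@funepos_le _ _ setT) => [? _|]; rewrite ?inE.
- exact: measurable_funeneg.
- exact: measurable_funeneg.
- by move=> t _; apply: (@funeneg_le _ _ setT) => [? _|]; rewrite ?inE.
Qed.

End RealIntegral.

(** * Integrating out a fresh sample in real-valued expressions *)

Section FreezingReal.
Context {R : realType} {d d' : measure_display}
  {T : measurableType d} {Om : measurableType d'}.
Variables (P : probability T R) (mu : probability Om R)
  (W : nat -> {RV P >-> Om}).
Hypothesis iidW : iid_on mu [set j | (2 <= j)%N] W.
Variables (j : nat) (j2 : (2 <= j)%N) (h : T -> Om -> R) (M : T -> R).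
Local Notation hist := (g_sigma_algebraType (past W j)).
Hypothesis mh : measurable_fun setT (fun p : hist * Om => h p.1 p.2).

Lemma freezing_eq : intg P (fun t => h t (W j t)) ->
  (forall t, (\int[mu]_w (h t w)%:E = (M t)%:E)%E) ->
  \int[P]_t h t (W j t) = \int[P]_t M t.
Proof.
move=> ih hM; congr fine.
rewrite (freezing iidW j2 (H := fun p => (h p.1 p.2)%:E))//.
- by apply: eq_integral => t _; rewrite hM.
- exact/measurable_EFinP.
Qed.

Lemma freezing_le : (forall t w, 0 <= h t w) ->
  (forall t, (\int[mu]_w (h t w)%:E <= (M t)%:E)%E) -> intg P M ->
  intg P (fun t => h t (W j t)) /\
  \int[P]_t h t (W j t) <= \int[P]_t M t.
Proof.
move=> h0 hM iM.
have mH : measurable_fun setT (fun p : hist * Om => (h p.1 p.2)%:E).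
  exact/measurable_EFinP.
have le : (\int[P]_t (h t (W j t))%:E <= (\int[P]_t M t)%:E)%E.
  rewrite -intg_Rintegral//.
  rewrite (ge0_freezing iidW j2 mH)//; last by move=> p; rewrite lee_fin.
  apply: ge0_le_integral => //.
  - by move=> t _; apply: integral_ge0 => w _; rewrite lee_fin.
  - apply: (@hist_fun _ _ _ _ _ P W _ _ j).
    apply: (measurable_fun_fubini_tonelli_F
      (fun p : hist * Om => (h p.1 p.2)%:E)) => //.
    by move=> p; rewrite lee_fin.
  - by apply/measurable_EFinP; exact: intg_measurable iM.
  - by move=> t _; exact: hM.
have iH : intg P (fun t => h t (W j t)).
  apply: intg_bound le => //.
  have mW : measurable_fun setT (fun t : T => (t : hist, W j t)).
    apply: measurable_fun_pair => //.
    by move=> _ B mB; rewrite setTI; exact: (@hist_measurable _ _ _ _ _ P W j).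
  exact: (measurableT_comp mh mW).
by split => //; rewrite -lee_fin -intg_Rintegral.
Qed.

End FreezingReal.

(** * Mean, variance and mean subgradients of random vectors *)

Section MeanVec.
Context {R : realType} {d : measure_display} {Om : measurableType d} {n : nat}.
Variable mu : probability Om R.
Implicit Types v : Om -> 'rV[R]_n.

Lemma variance_vecE v : variance_vec mu v =
  (\int[mu]_w (dotv (v w - mean_vec mu v) (v w - mean_vec mu v))%:E)%E.
Proof.
rewrite /variance_vec unlock; apply: eq_integral => w _ /=.
by rewrite enorm_sqr.
Qed.

Lemma measurable_dotv (d' : measure_display) (S : measurableType d')
    (u v : S -> 'rV[R]_n) :
  (forall j, measurable_fun setT (fun w => u w 0 j)) ->
  (forall j, measurable_fun setT (fun w => v w 0 j)) ->
  measurable_fun setT (fun w => dotv (u w) (v w)).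
Proof.
move=> mu_ mv; apply: measurable_sum => j.
by apply: measurable_funM; [exact: mu_|exact: mv].
Qed.

Lemma intg_dotvl v (a : 'rV[R]_n) : (forall j, intg mu (fun w => v w 0 j)) ->
  intg mu (fun w => dotv (v w) a).
Proof.
move=> iv; apply: intg_sum => j.
by under eq_fun do rewrite mulrC; exact: intgZ.
Qed.

(** The argument treats [mean_vec mu v] as an arbitrary constant vector, so it holds whatever
    default value [fine] may have produced: v minus a constant is square integrable, hence v is
    integrable, and [mean_vec] is then the true mean. *)
Lemma variance_intg v (c : R) : (forall j, measurable_fun setT (fun w => v w 0
  j)) ->
  (variance_vec mu v <= c%:E)%E -> forall j, intg mu (fun w => v w 0 j).
Proof.
rewrite variance_vecE => mv vc j; set a := mean_vec mu v in vc.
have mva i : measurable_fun setT (fun w => (v w - a) 0 i).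
  under eq_fun do rewrite !mxE.
  by apply: measurable_funB => //.
have ia : intg mu (fun w => (v w - a) 0 j).
  apply: intg_sqr => //.
  apply: (@intg_le _ _ _ _ _ (fun w => dotv (v w - a) (v w - a))).
  - exact: measurable_funX.
  - by move=> w; rewrite ger0_norm ?sqr_ge0// sqr_coord_le_dotv.
  - apply: intg_bound vc; first exact: measurable_dotv.
    by move=> w; exact: dotv_ge0.
have := intgD ia (intg_cst mu (a 0 j)).
by under eq_fun do rewrite !mxE subrK.
Qed.

Lemma mean_vecE v j : mean_vec mu v 0 j = \int[mu]_w v w 0 j.
Proof. by rewrite /mean_vec mxE unlock. Qed.

Lemma Rintegral_dotv v (a : 'rV[R]_n) :
  (forall j, intg mu (fun w => v w 0 j)) ->
  \int[mu]_w dotv (v w) a = dotv (mean_vec mu v) a.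
Proof.
move=> iv; rewrite Rintegral_sum.
  by apply: eq_bigr => j _; rewrite mean_vecE -RintegralZr//; exact: iv.
by move=> j; under eq_fun do rewrite mulrC; exact: intgZ.
Qed.

(** The subgradient inequality is integrated over the sample. At a point of [dom] outside X the
    right-hand side may have mean [+oo]; the affine minorant is integrable, which keeps the integral
    monotone. Boundedness assumptions on subgradients of the mean thereby apply to [mean_vec]. *)
Lemma mean_subgradient (dom : set 'rV[R]_n) (f : Om -> 'rV[R]_n -> R)
    v (y : 'rV[R]_n) :
  intg mu (fun w => f w y) -> (forall j, intg mu (fun w => v w 0 j)) ->
  (forall u, dom u -> measurable_fun setT (fun w => f w u)) ->
  (forall w, subdifferential dom (fun u => (f w u)%:E) y (v w)) ->
  subdifferential dom (mean mu f) y (mean_vec mu v).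
Proof.
move=> ify iv mf sub u domu; rewrite /mean unlock.
rewrite intg_Rintegral// -Rintegral_dotv// -EFinD -RintegralD//; last first.
  exact: intg_dotvl.
have iL := intgD ify (intg_dotvl (u - y) iv).
rewrite -intg_Rintegral//; apply: le_integral_minorant => //.
- by apply/measurable_EFinP; exact: mf.
- by move=> w; rewrite EFinD; exact: sub.
Qed.

End MeanVec.

Section JointMeasurability.
Context {R : realType} {n : nat} {d d' d1 : measure_display}
  {S : measurableType d} {Om : measurableType d'} {V : measurableType d1}.
Variables (X : set 'rV[R]_n) (cX : closed X).
Variables (h : Om -> 'rV[R]_n -> V) (mh : jointly_measurable X h).

Lemma jointly_measurable_comp (Y : S -> borelV R n) (w : S -> Om) :
  measurable_fun setT Y -> measurable_fun setT w -> (forall s, X (Y s)) ->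
  measurable_fun setT (fun s => h (w s) (Y s)).
Proof.
move=> mY mw XY.
pose Z s : Om * borelV R n := (w s, Y s).
apply: (@measurable_comp _ _ _ _ _ _ (setT `*` X : set (Om * borelV R n))
   (fun p => h p.1 p.2) setT Z) => //.
- apply: measurableX => //; rewrite -[X]setCK; apply: measurableC.
  by apply: sub_sigma_algebra; exact: closed_openC.
- by move=> _ [s _ <-]; split => //=; exact: XY.
- exact: measurable_fun_pair.
Qed.

End JointMeasurability.

(** * One iteration and the deterministic recursion *)

Lemma borel_vector_lipschitz (R : realType) (p q : nat) (d : measure_display)
    (T : measurableType d) (Y : T -> borelV R p) (Z : T -> borelV R q) (C : R) :
  0 <= C -> measurable_fun setT Y ->
  (forall t t', dotv (Z t - Z t' : 'rV[R]_q) (Z t - Z t' : 'rV[R]_q) <=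
     C * dotv (Y t - Y t' : 'rV[R]_p) (Y t - Y t' : 'rV[R]_p)) ->
  measurable_fun setT Z.
Proof.
move=> C0 mY YZ; apply: (borel_vector_modulus mY) => e e0.
(* Coordinates within e/D give squared Euclidean distance at most p (e/D)^2, and C p (e/D)^2 < D
   (e/D)^2 = e^2/D <= e^2. *)
pose D : R := C * p%:R + 1.
have D1 : 1 <= D by rewrite lerDr mulr_ge0.
have D0 : 0 < D := lt_le_trans ltr01 D1.
exists (e / D); first by rewrite divr_gt0.
move=> t t' [r0 Ytt']; split=> // i j; rewrite ord1 /ball/= -ltr_sqr ?nnegrE//;
  last exact: ltW.
rewrite real_normK ?num_real//.
have -> : (Z t : 'rV[R]_q) 0 j - Z t' 0 j = (Z t - Z t' : 'rV[R]_q) 0 j by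
  rewrite !mxE.
apply: le_lt_trans (sqr_coord_le_dotv _ j) _; apply: le_lt_trans (YZ t t') _.
have : dotv (Y t - Y t' : 'rV[R]_p) (Y t - Y t' : 'rV[R]_p) <= p%:R * (e / D)
  ^+ 2.
  rewrite mulr_natl -[in leRHS](card_ord p) -sumr_const; apply: ler_sum => k _.
  rewrite -expr2 -[leLHS]real_normK ?num_real// ler_sqr ?nnegrE ?(ltW r0)//.
  by have := Ytt' 0 k; rewrite /ball/= !mxE => /ltW.
move=> /(ler_wpM2l C0) h; apply: le_lt_trans h _.
rewrite mulrA (@lt_le_trans _ _ (D * (e / D) ^+ 2))//.
  by rewrite ltr_pM2r ?exprn_gt0// ltrDl.
have -> : D * (e / D) ^+ 2 = e ^+ 2 / D by field; rewrite gt_eqF.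
by rewrite ler_pdivrMr// ler_peMr// sqr_ge0.
Qed.

Lemma borel_scalar_lipschitz (R : realType) (p : nat) (d : measure_display)
    (T : measurableType d) (Y : T -> borelV R p) (h : T -> R) (C : R) :
  0 <= C -> measurable_fun setT Y ->
  (forall t t', (h t - h t') ^+ 2 <=
     C * dotv (Y t - Y t' : 'rV[R]_p) (Y t - Y t' : 'rV[R]_p)) ->
  measurable_fun setT h.
Proof.
move=> C0 mY Yh.
have mZ : measurable_fun setT ((fun t => \row_(j < 1) h t) : T -> borelV R 1).
  apply: (borel_vector_lipschitz C0 mY) => t t'.
  by rewrite /dotv big_ord1 !mxE -expr2; exact: Yh.
have := measurableT_comp (@borel_coord_measurable R 1 0) mZ.
by apply: eq_measurable_fun => t _; rewrite /= mxE.
Qed.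

(** * Inequalities for one primal and one dual step *)

Section Steps.
Context {R : realType} {n m : nat}.

Lemma lagrangian_vec_le (z : 'rV[R]_m) (a : 'rV[R]_n) (b : 'I_m -> 'rV[R]_n)
    (ca : R) (cb : 'I_m -> R) :
  dotv a a <= ca -> (forall i, dotv (b i) (b i) <= cb i) ->
  dotv (a + \sum_i z 0 i *: b i) (a + \sum_i z 0 i *: b i) <=
    2 * (ca + dotv z z * \sum_i cb i).
Proof.
move=> aca bcb; apply: le_trans (dotvD_le _ _) _.
rewrite mulrDr lerD ?ler_pM2l//.
apply: le_trans (dotv_sumZ_le _ _) _.
by rewrite ler_wpM2l ?dotv_ge0//; exact: ler_sum.
Qed.

(* [a] and [b] are subgradients of [L] at [x] and [p], and [v - a] is the
   sampling noise. *)
Lemma primal_step (X : set 'rV[R]_n) (L : 'rV[R]_n -> R) v a b x p xs (c Q : R)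
  :
  (forall y z (t : R), X y -> X z -> 0 <= t <= 1 ->
     X (t *: y + (1 - t) *: z)) ->
  0 < c ->
  is_argmin X (fun y => dotv v (y - x) + (2 * c)^-1 * enorm (y - x) ^+ 2) p ->
  X xs ->
  L x + dotv a (xs - x) <= L xs -> L p + dotv b (x - p) <= L x ->
  dotv a a <= Q -> dotv b b <= Q ->
  4 * c * (L p - L xs) <=
    2 * dotv (xs - x) (xs - x) - 2 * dotv (xs - p) (xs - p)
    + 16 * c ^+ 2 * Q + 4 * c ^+ 2 * dotv (v - a) (v - a)
    - 4 * c * dotv (v - a) (x - xs).
Proof.
move=> cX c0 pmin Xxs La Lb aQ bQ.
have three := prox_three_point cX c0 pmin Xxs.
(* Twice the three-point inequality offers -2|p - x|^2; each of the two Young inequalities consumes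
   one |p - x|^2. The weight 2c leaves 4 c^2 |b - a|^2 <= 16 c^2 Q and 4 c^2 |v - a|^2. *)
have y1 := dotv_young ((2 * c) *: (b - a)) (p - x).
have y2 := dotv_young (- (2 * c) *: (v - a)) (p - x).
have ba : dotv (b - a) (b - a) <= 4 * Q.
  by have := dotvD_le b (- a); rewrite !dotvNl !dotvNr; lra.
have c4 : 0 <= 4 * c by lra.
have c2 : 0 <= 4 * c ^+ 2 by rewrite mulr_ge0// sqr_ge0.
have {ba}ba := ler_wpM2l c2 ba.
(* The two subgradient inequalities bound the left side by <b, p - x> + <a, x - xs>, here rewritten
   so that the noise splits at x: the part along p - x is absorbed, the part along x - xs has mean
   zero later. *)
have L1 : L p - L xs <= dotv (b - a) (p - x) + dotv v (p - xs)
    - dotv (v - a) (p - x) - dotv (v - a) (x - xs).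
  by move: La Lb; rewrite !dotvE; lra.
have {L1}L1 := ler_wpM2l c4 L1.
apply: le_trans L1 _.
move: y1 y2 ba three.
rewrite !(dotvZl, dotvZr).
move: (dotv (b - a) (p - x)) (dotv (v - a) (p - x)) (dotv (v - a) (x - xs))
  (dotv (b - a) (b - a)) (dotv (v - a) (v - a)) (dotv (p - x) (p - x))
  (dotv v (p - xs)) (dotv (xs - x) (xs - x)) (dotv (xs - p) (xs - p)).
by move=> ? ? ? ? ? ? ? ? ?; lra.
Qed.

(** The three-point inequality controls <g, zt - z'>; the remaining <g, z' - z> is paid by its term
    -|z' - z|^2 through Young's inequality. *)
Lemma dual_step (g z z' zt : 'rV[R]_m) (c : R) :
  0 < c ->
  is_argmax (@orthant R m)
    (fun y => dotv g (y - z) - (2 * c)^-1 * enorm (y - z) ^+ 2) z' ->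
  orthant zt ->
  4 * c * dotv g (zt - z) <=
    2 * dotv (zt - z) (zt - z) - 2 * dotv (zt - z') (zt - z')
    + 2 * c ^+ 2 * dotv g g.
Proof.
move=> c0 /orthant_argmax_min zmin zt0.
have three := prox_three_point (@orthant_convex R m) c0 zmin zt0.
have y1 := dotv_young (c *: g) (z' - z).
have -> : dotv g (zt - z) = dotv (- g) (z' - zt) + dotv g (z' - z).
  by rewrite !dotvE; lra.
move: three y1; rewrite !(dotvZl, dotvZr).
move: (dotv (- g) (z' - zt)) (dotv g (z' - z)) (dotv g g)
  (dotv (zt - z) (zt - z)) (dotv (zt - z') (zt - z'))  (dotv (z' - z) (z' - z)).
by move=> ? ? ? ? ? ?; lra.
Qed.

End Steps.

(** * The recursion on second moments, without probability *)

Section RealRecursion.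
Context {R : realType}.
Variables (K : nat) (gamma B : nat -> R) (P1 P2 P3 b : R).
Hypothesis gamma_gt0 : forall k, (1 <= k <= K)%N -> 0 < gamma k.
Let S2 := \sum_(1 <= k < K.+1) gamma k ^+ 2.
Hypotheses (P1_ge0 : 0 <= P1) (P2_ge0 : 0 <= P2) (b_ge0 : 0 <= b)
  (bP3 : b <= P3) (S2P3 : P3 * S2 < 1).
Let M := (P1 + P2 * S2) / (1 - P3 * S2).

(** Applied with [l] the expected Lagrangian gap at u, [a k] = E|x_k - xs|^2 + E|z_k - u|^2 and
    [B k] = E|z_k|^2. *)
Definition descent (l a : nat -> R) := forall k, (1 <= k <= K)%N ->
  4 * gamma k * l k <=
    2 * a k - 2 * a k.+1 + gamma k ^+ 2 * (P2 + b * B k).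

Lemma descent_sum (l a : nat -> R) (j : nat) : descent l a -> (j <= K)%N ->
  \sum_(1 <= k < j.+1) 4 * gamma k * l k + 2 * a j.+1 <=
    2 * a 1%N + \sum_(1 <= k < j.+1) gamma k ^+ 2 * (P2 + b * B k).
Proof.
move=> des; elim: j => [|j IH] jK; first by rewrite !big_geq// add0r addr0.
rewrite big_nat_recr//= [in leRHS]big_nat_recr//=.
by have := IH (ltnW jK); have := des j.+1 jK; lra.
Qed.

Let S2_ge0 : 0 <= S2.
Proof. by apply: sumr_ge0 => k _; rewrite sqr_ge0. Qed.

Let M_ge0 : 0 <= M.
Proof.
apply: divr_ge0; last by rewrite subr_ge0 ltW.
by apply: addr_ge0 => //; exact: mulr_ge0.
Qed.

(** [M] is the fixed point of the affine map by which a bound on the earlier [B i] yields a bound on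
    [B k]; this is where the final fraction comes from. *)
Let ME : P1 + P2 * S2 + P3 * S2 * M = M.
Proof.
have : 1 - P3 * S2 != 0 by rewrite gt_eqF// subr_gt0.
by move=> nz; rewrite /M; field.
Qed.

Let weights_le j : (j <= K)%N -> (forall k, (1 <= k <= j)%N -> B k <= M) ->
  \sum_(1 <= k < j.+1) gamma k ^+ 2 * (P2 + b * B k) <= P2 * S2 + P3 * S2 * M.
Proof.
move=> jK BM; have cP : 0 <= P2 + b * M.
  by apply: addr_ge0 => //; exact: mulr_ge0 M_ge0.
apply: (@le_trans _ _ (\sum_(1 <= k < j.+1) gamma k ^+ 2 * (P2 + b * M))).
  rewrite big_nat_cond [in leRHS]big_nat_cond; apply: ler_sum => k.
  rewrite andbT ltnS => kj; rewrite ler_wpM2l ?sqr_ge0// lerD2l.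
  by rewrite ler_wpM2l// BM.
rewrite -mulr_suml; apply: (@le_trans _ _ (S2 * (P2 + b * M))).
  rewrite ler_wpM2r// /S2 [leRHS](@big_cat_nat _ _ _ j.+1)//= lerDl.
  by apply: sumr_ge0 => k _; rewrite sqr_ge0.
rewrite mulrDr [S2 * P2]mulrC lerD2l mulrA [leRHS]mulrAC -mulrAC.
by rewrite ![_ * S2]mulrC -!mulrA ler_wpM2l// ler_wpM2r.
Qed.

(** Strong induction: the nonnegative [l i] drop out of the summed descent, leaving [2 * a k]
    bounded through the earlier [B i]. The constant [c] pays for passing from |z_k - zs|^2 to
    |z_k|^2. *)
Lemma second_moment_bound (l a : nat -> R) (c : R) :
  descent l a -> (forall k, (1 <= k <= K)%N -> 0 <= l k) ->
  (forall k, (1 <= k <= K)%N -> B k <= 2 * a k + c) ->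
  2 * a 1%N + c <= P1 ->
  forall k, (1 <= k <= K)%N -> B k <= M.
Proof.
move=> des l0 Ba a1.
elim/ltn_ind => -[//|k] IH /andP[_ kK].
apply: le_trans (Ba _ _) _; first by rewrite kK.
have BM i : (1 <= i <= k)%N -> B i <= M.
  by move=> /andP[i1 ik]; apply: IH => //; rewrite i1 (leq_trans ik)// ltnW.
have l_ge0 : 0 <= \sum_(1 <= i < k.+1) 4 * gamma i * l i.
  rewrite big_nat_cond; apply: sumr_ge0 => i /andP[/andP[i1 ik] _].
  have iK : (1 <= i <= K)%N by rewrite i1 (leq_trans _ (ltnW kK)).
  by rewrite mulr_ge0 ?l0// mulr_ge0// ltW// gamma_gt0.
have des_k := descent_sum des (ltnW kK); have w_k := weights_le (ltnW kK) BM.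
rewrite -[leRHS]ME -addrA; apply: (@le_trans _ _ (2 * a 1%N + c +
    \sum_(1 <= i < k.+1) gamma i ^+ 2 * (P2 + b * B i))); last exact: lerD.
rewrite addrAC lerD2r; by apply: le_trans des_k; rewrite lerDr.
Qed.

Lemma descent_bound (l a : nat -> R) :
  descent l a -> (forall k, 0 <= a k) -> 2 * a 1%N <= P1 ->
  (forall k, (1 <= k <= K)%N -> B k <= M) ->
  4 * \sum_(1 <= k < K.+1) gamma k * l k <= M.
Proof.
move=> des a0 a1 BM.
have des_K := descent_sum des (leqnn K); have w_K := weights_le (leqnn K) BM.
rewrite -[leRHS]ME -addrA; apply: le_trans (lerD a1 w_K).
apply: le_trans des_K; rewrite mulr_sumr.
under eq_bigr do rewrite mulrA.
by rewrite lerDl mulr_ge0.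
Qed.

End RealRecursion.

(** * Mean of a random convex function *)

Section Expectation.
Context {R : realType} {d : measure_display} {T : measurableType d}.
Variable P : probability T R.
Implicit Types h k : T -> R.

(** Carrying integrability with the value lets long linear combinations be integrated term by
    term. *)
Definition hasE h (u : R) := intg P h /\ \int[P]_t h t = u.

Lemma intg_hasE h : intg P h -> hasE h (\int[P]_t h t). Proof. by []. Qed.

Lemma hasE_cst (c : R) : hasE (fun=> c) c.
Proof. by split; [exact: intg_cst|rewrite Rintegral_prob_cst]. Qed.

Lemma hasED h k u v : hasE h u -> hasE k v -> hasE (fun t => h t + k t) (u + v).
Proof. by move=> [ih <-] [ik <-]; split; [exact: intgD|rewrite RintegralD]. Qed.

Lemma hasEZ (c : R) h u : hasE h u -> hasE (fun t => c * h t) (c * u).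
Proof. by move=> [ih <-]; split; [exact: intgZ|rewrite RintegralZl]. Qed.

Lemma hasEB h k u v : hasE h u -> hasE k v -> hasE (fun t => h t - k t) (u - v).
Proof. by move=> [ih <-] [ik <-]; split; [exact: intgB|rewrite RintegralB]. Qed.

Lemma hasE_sum (I : Type) (r : seq I) (h : I -> T -> R) (u : I -> R) :
  (forall i, hasE (h i) (u i)) ->
  hasE (fun t => \sum_(i <- r) h i t) (\sum_(i <- r) u i).
Proof.
move=> hu; split; first by apply: intg_sum => i; have [] := hu i.
rewrite Rintegral_sum; last by move=> i; have [] := hu i.
by apply: eq_bigr => i _; have [] := hu i.
Qed.

Lemma hasE_le h k u v : hasE h u -> hasE k v -> (forall t, h t <= k t) -> u <=
  v.
Proof. by move=> [ih <-] [ik <-] hk; exact: le_Rintegral. Qed.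

End Expectation.

Lemma dotv_sqr_le (R : realType) (n : nat) (u v : 'rV[R]_n) :
  dotv u v ^+ 2 <= dotv u u * dotv v v.
Proof. exact: cauchy_sum. Qed.

(** * Subgradient oracle of a random convex function *)

Section ConvexOracle.
Context {R : realType} {n : nat} {d d' : measure_display}
  {T : measurableType d} {Om : measurableType d'}.
Variables (P : probability T R) (mu : probability Om R)
  (W : nat -> {RV P >-> Om}).
Hypothesis iidW : iid_on mu [set j | (2 <= j)%N] W.
Variables (X dom : set 'rV[R]_n) (h : Om -> 'rV[R]_n -> R)
  (gradh : Om -> 'rV[R]_n -> 'rV[R]_n) (C s : R).
Hypotheses (cX : closed X) (XD : X `<=` dom)
  (ih : forall y, X y -> mu.-integrable setT (fun w => (h w y)%:E))
  (sub : forall w y, X y ->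
    subdifferential dom (fun v => (h w v)%:E) y (gradh w y))
  (mh : forall y, dom y -> measurable_fun setT (fun w => h w y))
  (jgrad : jointly_measurable X (gradh : Om -> 'rV[R]_n -> borelV R n))
  (bnd : forall y s, X y -> subdifferential dom (mean mu h) y s -> enorm s <= C)
  (var : forall y, X y ->
    (variance_vec mu (fun w => gradh w y) <= (s ^+ 2)%:E)%E).

(** The section is instantiated by f and by every g^i. [H] represents the mean on X, where it is
    finite. *)
Let H y : R := fine (mean mu h y).
Let m y : 'rV[R]_n := mean_vec mu (fun w => gradh w y).

Lemma meanE y : X y -> mean mu h y = (H y)%:E.
Proof.
by move=> Xy; rewrite /H /mean unlock fineK// integrable_fin_num//; exact: ih.
Qed.

Lemma grad_coord_measurable (d1 : measure_display) (S : measurableType d1)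
    (Y : S -> borelV R n) (w : S -> Om) j :
  measurable_fun setT Y -> measurable_fun setT w -> (forall t, X (Y t)) ->
  measurable_fun setT (fun t => gradh (w t) (Y t) 0 j).
Proof.
move=> mY mw XY.
have mG := jointly_measurable_comp cX jgrad mY mw XY.
exact: measurableT_comp (borel_coord_measurable j) mG.
Qed.

Lemma grad_measurable y j : X y -> measurable_fun setT (fun w => gradh w y 0 j).
Proof. by move=> Xy; apply: grad_coord_measurable. Qed.

Lemma grad_intg y j : X y -> intg mu (fun w => gradh w y 0 j).
Proof.
move=> Xy; apply: (@variance_intg _ _ _ _ _ (fun w => gradh w y)).
  by move=> i; exact: grad_measurable.
exact: var.
Qed.

Lemma mean_grad_subdifferential y : X y ->
  subdifferential dom (mean mu h) y (m y).
Proof.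
move=> Xy; apply: mean_subgradient => //.
- exact: ih.
- by move=> j; exact: grad_intg.
- by move=> w; exact: sub.
Qed.

Lemma mean_subgradient_le y u : X y -> X u -> H y + dotv (m y) (u - y) <= H u.
Proof.
move=> Xy Xu; have := mean_grad_subdifferential Xy (XD Xu).
by rewrite !meanE// -EFinD lee_fin.
Qed.

Lemma mean_grad_sqr y : X y -> dotv (m y) (m y) <= C ^+ 2.
Proof.
move=> Xy; rewrite -enorm_sqr; have mC := bnd Xy (mean_grad_subdifferential Xy).
by rewrite ler_sqr ?nnegrE ?sqrtr_ge0// (le_trans _ mC) ?sqrtr_ge0.
Qed.

(** The subgradient at the point with the larger value bounds the difference; Cauchy-Schwarz and the
    bound [C] conclude. Measurability and second moments of [H] at random points rest on this. *)
Lemma mean_lipschitz y u : X y -> X u ->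
  (H y - H u) ^+ 2 <= C ^+ 2 * dotv (y - u) (y - u).
Proof.
move=> Xy Xu.
wlog Hyu : y u Xy Xu / H u <= H y.
  move=> wl; have [|/ltW] := leP (H u) (H y); first exact: wl.
  by move=> /(wl u y Xu Xy); rewrite -[y - u]opprB dotvNl dotvNr opprK -sqrrN
    opprB.
have := mean_subgradient_le Xy Xu; rewrite -[u - y]opprB dotvNr => h1.
have h2 : (H y - H u) ^+ 2 <= dotv (m y) (y - u) ^+ 2.
  have ? : H y - H u <= dotv (m y) (y - u) by lra.
  by rewrite ler_sqr ?nnegrE ?subr_ge0// (le_trans _ (_ : H y - H u <= _))//
    subr_ge0.
apply: le_trans h2 _; apply: le_trans (dotv_sqr_le _ _) _.
by rewrite ler_wpM2r ?dotv_ge0// mean_grad_sqr.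
Qed.

Lemma mean_comp_measurable (d1 : measure_display) (S : measurableType d1)
    (Y : S -> borelV R n) :
  measurable_fun setT Y -> (forall t, X (Y t)) ->
  measurable_fun setT (fun t => H (Y t)).
Proof.
move=> mY XY; apply: (borel_scalar_lipschitz (C := C ^+ 2) _ mY).
  exact: sqr_ge0.
by move=> t t'; exact: mean_lipschitz.
Qed.

Lemma mean_comp_sqr_intg (Y : T -> borelV R n) (a : 'rV[R]_n) :
  measurable_fun setT Y -> (forall t, X (Y t)) -> X a ->
  intg P (fun t => dotv (Y t - a : 'rV[R]_n) (Y t - a : 'rV[R]_n)) ->
  intg P (fun t => H (Y t) ^+ 2).
Proof.
move=> mY XY Xa iY.
apply: (intg_le _ _ (intgD (intg_cst P (2 * H a ^+ 2)) (intgZ (2 * C ^+ 2)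
  iY))).
  by apply: measurable_funX; exact: mean_comp_measurable.
move=> t; rewrite ger0_norm ?sqr_ge0//.
have := mean_lipschitz (XY t) Xa.
(* This square is 2 a^2 + 2 (h - a)^2 - h^2, with h and a standing for the two values of [H]. *)
have := sqr_ge0 (H (Y t) - 2 * H a).
by move: (dotv _ _) => D; nra.
Qed.

(** * Sampling noise: second moment and vanishing mean *)

Section noise.
Variables (j : nat) (j2 : (2 <= j)%N).
Local Notation hist := (g_sigma_algebraType (past W j)).
Variables (Y : T -> borelV R n).
Hypotheses (mY : measurable_fun setT (Y : hist -> borelV R n))
  (XY : forall t, X (Y t)).

Let Y_fst : measurable_fun setT (fun p : hist * Om => Y p.1).
Proof. exact: measurableT_comp mY measurable_fst. Qed.

Let grad_fst i :
  measurable_fun setT (fun p : hist * Om => gradh p.2 (Y p.1) 0 i).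
Proof.
exact: (@grad_coord_measurable _ _ (fun p : hist * Om => Y p.1) snd).
Qed.

(** The subgradient selection has no continuity in the point, so measurability comes from Tonelli's
    theorem applied to the positive and negative parts. *)
Lemma mean_grad_measurable i :
  measurable_fun setT ((fun t => m (Y t) 0 i) : hist -> R).
Proof.
under eq_fun do rewrite /m mean_vecE.
have mg : measurable_fun setT
    (fun p : hist * Om => (gradh p.2 (Y p.1) 0 i)%:E).
  by apply/measurable_EFinP; exact: grad_fst.
apply: measurableT_comp => //.
rewrite (_ : (fun t => _) = (fun t =>
   (\int[mu]_w (fun p : hist * Om => (gradh p.2 (Y p.1) 0 i)%:E)^\+ (t, w) -
    \int[mu]_w (fun p : hist * Om => (gradh p.2 (Y p.1) 0 i)%:E)^\- (t, w))%E)).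
  apply: emeasurable_funB.
    apply: (measurable_fun_fubini_tonelli_F
      ((fun p : hist * Om => (gradh p.2 (Y p.1) 0 i)%:E)^\+)%E) => //.
    exact: measurable_funepos.
  apply: (measurable_fun_fubini_tonelli_F
    ((fun p : hist * Om => (gradh p.2 (Y p.1) 0 i)%:E)^\-)%E) => //.
  exact: measurable_funeneg.
apply/funext => t; rewrite integralE.
by congr (_ - _)%E; apply: eq_integral => w _; rewrite ?funeposE ?funenegE.
Qed.

Let noise_coord i : measurable_fun setT
  (fun p : hist * Om => (gradh p.2 (Y p.1) - m (Y p.1)) 0 i).
Proof.
under eq_fun do rewrite mxE [X in _ + X]mxE.
apply: measurable_funB; first exact: grad_fst.
exact: measurableT_comp (mean_grad_measurable i) measurable_fst.
Qed.

Definition noise t : 'rV[R]_n := gradh (W j t) (Y t) - m (Y t).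

(** The weight [q] depends on the past only and is frozen together with [Y]. It is 1 for the
    objective, |z_k|^2 for the constraints, and [a ^+ 2] in the integrability part of
    [noise_mean0]. *)
Lemma noise_sqr_le (q : T -> R) :
  measurable_fun setT (q : hist -> R) -> (forall t, 0 <= q t) -> intg P q ->
  intg P (fun t => q t * dotv (noise t) (noise t)) /\
  \int[P]_t (q t * dotv (noise t) (noise t)) <= s ^+ 2 * \int[P]_t q t.
Proof.
move=> mq q0 iq; rewrite -RintegralZl//.
pose h2 t w := q t * dotv (gradh w (Y t) - m (Y t)) (gradh w (Y t) - m (Y t)).
apply: (freezing_le iidW j2 (h := h2)).
- apply: measurable_funM; first exact: measurableT_comp mq measurable_fst.
  by apply: measurable_dotv => i; exact: noise_coord.
- by move=> t w; rewrite mulr_ge0 ?dotv_ge0.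
- move=> t; under eq_integral do rewrite EFinM.
  rewrite ge0_integralZl//; last 2 first.
  + by move=> w _; rewrite lee_fin dotv_ge0.
  + by rewrite lee_fin.
  + rewrite [(s ^+ 2 * _)%R]mulrC EFinM lee_wpmul2l ?lee_fin//.
    by rewrite -variance_vecE; exact: var.
  + apply/measurable_EFinP; apply: measurable_dotv => i;
      under eq_fun do rewrite !mxE;
      by apply: measurable_funB => //; exact: grad_measurable.
- exact: intgZ.
Qed.

(** A product of three random factors is integrable with second moments of [a] and [b] alone,
    because Young's inequality is applied to a * noise and b, and [noise_sqr_le] with weight a^2
    handles the former. *)
Lemma noise_mean0 (a : T -> R) (b : T -> 'rV[R]_n) :
  measurable_fun setT (a : hist -> R) ->
  (forall i, measurable_fun setT ((fun t => b t 0 i) : hist -> R)) ->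
  intg P (fun t => a t ^+ 2) -> intg P (fun t => dotv (b t) (b t)) ->
  hasE P (fun t => a t * dotv (noise t) (b t)) 0.
Proof.
move=> ma mb ia ib.
pose h1 t w := a t * dotv (gradh w (Y t) - m (Y t)) (b t).
have mh1 : measurable_fun setT (fun p : hist * Om => h1 p.1 p.2).
  apply: measurable_funM; first exact: measurableT_comp ma measurable_fst.
  apply: measurable_dotv => i; first exact: noise_coord.
  exact: measurableT_comp (mb i) measurable_fst.
have [] := @noise_sqr_le (fun t => a t ^+ 2) _ _ ia.
- exact: measurable_funX.
- by move=> t; exact: sqr_ge0.
move=> ie _.
have ih1 : intg P (fun t => h1 t (W j t)).
  apply: (intg_le _ _ (intgD ie ib)).
    have mW : measurable_fun setT (fun t : T => (t : hist, W j t)).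
      apply: measurable_fun_pair => //.
      by move=> _ B mB; rewrite setTI; exact: (@hist_measurable _ _ _ _ _ P W
        j).
    exact: (measurableT_comp mh1 mW).
  move=> t; rewrite /h1 -/(noise t).
  have := dotv_young (a t *: noise t) (b t).
  have := dotv_young (- a t *: noise t) (b t).
  have := dotv_ge0 (a t *: noise t); have := dotv_ge0 (b t).
  rewrite !dotvZl !dotvZr.
  move: (dotv _ (b t)) (dotv _ (noise t)) (dotv (b t) _) => ? ? ? ? ? ? ?.
  by rewrite ler_norml; apply/andP; split; lra.
split=> //.
rewrite (freezing_eq iidW j2 (h := h1) (M := fun=> 0))//.
  exact: Rintegral_prob_cst.
move=> t.
have ig i : intg mu (fun w => (gradh w (Y t) - m (Y t)) 0 i).
  under eq_fun do rewrite !mxE.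
  by apply: intgB; [exact: grad_intg|exact: intg_cst].
rewrite intg_Rintegral; last by apply: intgZ; exact: intg_dotvl.
congr EFin; rewrite RintegralZl//; last exact: intg_dotvl.
rewrite (Rintegral_dotv (v := fun w => gradh w (Y t) - m (Y t)) (b t) ig).
suff -> : mean_vec mu (fun w => gradh w (Y t) - m (Y t)) = 0.
  by rewrite dotvC dotv0r mulr0.
apply/rowP => i; rewrite mean_vecE [RHS]mxE.
have -> : (\int[mu]_w (gradh w (Y t) - m (Y t)) 0 i) =
    \int[mu]_w (gradh w (Y t) 0 i - m (Y t) 0 i).
  by apply: eq_Rintegral => w _; rewrite !mxE.
rewrite RintegralB//; [|exact: grad_intg|exact: intg_cst].
by rewrite Rintegral_prob_cst /m mean_vecE subrr.
Qed.

End noise.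
End ConvexOracle.

(** * Moments of the iterates *)

Section Averages.
Context {R : realType} {n : nat}.
Variables (K : nat) (gamma : nat -> R) (y : nat -> 'rV[R]_n).
Hypotheses (K_gt0 : (0 < K)%N)
  (gamma_gt0 : forall k, (1 <= k <= K)%N -> 0 < gamma k).
Let S j := \sum_(1 <= k < j.+1) gamma k.
Let avg j := (S j)^-1 *: \sum_(1 <= k < j.+1) gamma k *: y k.

Let S_gt0 j : (0 < j <= K)%N -> 0 < S j.
Proof.
elim: j => // -[_ K1|j IH jK]; rewrite /S big_nat_recr//=.
  by rewrite big_geq// add0r gamma_gt0.
by rewrite addr_gt0 ?gamma_gt0// IH//=; exact: ltnW.
Qed.

Lemma sum_weights_gt0 : 0 < \sum_(1 <= k < K.+1) gamma k.
Proof. by apply: S_gt0; rewrite K_gt0 /=. Qed.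

Lemma convex_average (X : set 'rV[R]_n) :
  (forall u v (t : R), X u -> X v -> 0 <= t <= 1 ->
     X (t *: u + (1 - t) *: v)) ->
  (forall k, (1 <= k <= K)%N -> X (y k)) ->
  X ((\sum_(1 <= k < K.+1) gamma k)^-1 *:
     \sum_(1 <= k < K.+1) gamma k *: y k).
Proof.
move=> cX Xy; suff : forall j, (0 < j <= K)%N -> X (avg j).
  by apply; rewrite K_gt0 /=.
elim=> // -[_ K1|j IH jK].
  rewrite /avg /S !big_nat1 scalerA mulVf ?scale1r; first exact: Xy.
  by rewrite gt_eqF// gamma_gt0.
have j1K : (0 < j.+1 <= K)%N by rewrite /= ltnW.
have S1 := S_gt0 j1K; have S2 := S_gt0 jK; have g2 := gamma_gt0 jK.
have S12 : S j.+2 = S j.+1 + gamma j.+2 by rewrite /S big_nat_recr.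
have -> : avg j.+2 = (S j.+1 / S j.+2) *: avg j.+1
    + (1 - S j.+1 / S j.+2) *: y j.+2.
  rewrite /avg scalerA mulrAC mulfV ?gt_eqF// mul1r big_nat_recr//= scalerDr.
  by congr (_ + _); rewrite scalerA; congr (_ *: _);
    move: S2; rewrite S12 => S2; field; rewrite gt_eqF.
apply: cX; [exact: IH|exact: Xy|].
rewrite divr_ge0 ?(ltW S1) ?(ltW S2)//= ler_pdivrMr// mul1r S12.
by rewrite lerDl ltW.
Qed.

(** Averaging the affine minorant that supports [h] at [ybar] kills its linear part, since the
    weighted deviations from [ybar] sum to zero. *)
Lemma jensen_subgradient (h : 'rV[R]_n -> R) (s : 'rV[R]_n) :
  let ybar := (\sum_(1 <= k < K.+1) gamma k)^-1 *:
              \sum_(1 <= k < K.+1) gamma k *: y k in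
  (forall k, (1 <= k <= K)%N -> h ybar + dotv s (y k - ybar) <= h (y k)) ->
  h ybar <= (\sum_(1 <= k < K.+1) gamma k)^-1 *
            \sum_(1 <= k < K.+1) gamma k * h (y k).
Proof.
move=> ybar hs; have S0 := sum_weights_gt0.
rewrite -(ler_pM2l S0) mulrA mulfV ?gt_eqF// mul1r.
have -> : (\sum_(1 <= k < K.+1) gamma k) * h ybar =
    \sum_(1 <= k < K.+1) gamma k * (h ybar + dotv s (y k - ybar)).
  under [RHS]eq_bigr do rewrite mulrDr -dotvZr dotvC scalerBr.
  rewrite big_split/= -mulr_suml -dotv_suml sumrB -scaler_suml /ybar scalerA.
  by rewrite mulfV ?gt_eqF// scale1r subrr dotvC dotv0r addr0.
rewrite big_nat_cond [leRHS]big_nat_cond; apply: ler_sum => k.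
rewrite andbT ltnS => kK; rewrite ler_wpM2l ?hs//.
by rewrite ltW// gamma_gt0.
Qed.

(** Lets [jensen_subgradient] apply to the squared distance to [w], whose gradient at [v] is 2 (v -
    w). *)
Lemma sqr_dist_subgradient (u v w : 'rV[R]_n) :
  dotv (v - w) (v - w) + dotv (2 *: (v - w)) (u - v) <= dotv (u - w) (u - w).
Proof.
have := dotv_ge0 (u - v); rewrite !dotvE (dotvC v u) (dotvC w u) (dotvC w v).
by lra.
Qed.

End Averages.

(** * The primal-dual iterates *)

Section PrimalDual.
Context {R : realType} {n m : nat} {d d' : measure_display}
  {Om : measurableType d} {T : measurableType d'}.
Variables (mu : probability Om R) (X dom : set 'rV[R]_n)
  (f : Om -> 'rV[R]_n -> R) (g : 'I_m -> Om -> 'rV[R]_n -> R)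
  (gradf : Om -> 'rV[R]_n -> 'rV[R]_n)
  (gradg : 'I_m -> Om -> 'rV[R]_n -> 'rV[R]_n)
  (CF sigmaF : R) (CG sigmaG DG : 'rV[R]_m)
  (P : probability T R) (W : nat -> {RV P >-> Om})
  (gamma : nat -> R) (K : nat) (x1 : 'rV[R]_n)
  (x : nat -> T -> 'rV[R]_n) (z : nat -> T -> 'rV[R]_m)
  (xs : 'rV[R]_n) (zs : 'rV[R]_m).
Hypotheses (cX : closed X) (convX : convex_set X) (XD : X `<=` dom)
  (fi : forall y, X y -> mu.-integrable setT (fun w => (f w y)%:E))
  (gi : forall i y, X y -> mu.-integrable setT (fun w => (g i w y)%:E))
  (fsub : forall w y, X y ->
    subdifferential dom (fun v => (f w v)%:E) y (gradf w y))
  (gsub : forall i w y, X y ->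
    subdifferential dom (fun v => (g i w v)%:E) y (gradg i w y))
  (fm : forall y, dom y -> measurable_fun setT (fun w => f w y))
  (gm : forall i y, dom y -> measurable_fun setT (fun w => g i w y))
  (gjm : forall i, jointly_measurable X (g i))
  (gradf_jm : jointly_measurable X (gradf : Om -> 'rV[R]_n -> borelV R n))
  (gradg_jm : forall i,
    jointly_measurable X (gradg i : Om -> 'rV[R]_n -> borelV R n))
  (CF_bound : forall y s, X y -> subdifferential dom (mean mu f) y s ->
    enorm s <= CF)
  (CG_bound : forall i y s, X y -> subdifferential dom (mean mu (g i)) y s ->
    enorm s <= CG 0 i)
  (f_var : forall y, X y ->
    (variance_vec mu (fun w => gradf w y) <= (sigmaF ^+ 2)%:E)%E)
  (g_var : forall i y, X y ->
    (variance_vec mu (fun w => gradg i w y) <= (sigmaG 0 i ^+ 2)%:E)%E)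
  (DG_bound : forall i y, X y ->
    ('E_mu[fun w => (`|g i w y| ^+ 2)%R] <= (DG 0 i ^+ 2)%:E)%E)
  (saddle : saddle_point X (mean mu f) (fun i => mean mu (g i)) xs zs)
  (gamma_gt0 : forall k, (1 <= k <= K)%N -> 0 < gamma k)
  (Xx1 : X x1)
  (iidW : iid_on mu [set j | (2 <= j)%N] W)
  (iterates : primal_dual_iterates X g gradf gradg gamma K W x1 x z).

Let F y : R := fine (mean mu f y).
Let G i y : R := fine (mean mu (g i) y).
Let mF y : 'rV[R]_n := mean_vec mu (fun w => gradf w y).
Let mG i y : 'rV[R]_n := mean_vec mu (fun w => gradg i w y).
Let Xcomb := convex_setE convX.

Let Xxs : X xs. Proof. by have [] := saddle. Qed.
Let zs_ge0 : orthant zs. Proof. by have [] := saddle. Qed.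

Let FE y : X y -> mean mu f y = (F y)%:E.
Proof. by move=> Xy; exact: (meanE fi Xy). Qed.

Let GE i y : X y -> mean mu (g i) y = (G i y)%:E.
Proof. by move=> Xy; exact: (meanE (gi i) Xy). Qed.

Let Fsub y u : X y -> X u -> F y + dotv (mF y) (u - y) <= F u.
Proof. exact: (mean_subgradient_le cX XD fi fsub fm gradf_jm f_var). Qed.

Let Gsub i y u : X y -> X u -> G i y + dotv (mG i y) (u - y) <= G i u.
Proof.
exact: (mean_subgradient_le cX XD (gi i) (gsub i) (gm i)
  (gradg_jm i) (g_var i)).
Qed.

Let mF_sqr y : X y -> dotv (mF y) (mF y) <= CF ^+ 2.
Proof. exact: (mean_grad_sqr cX fi fsub fm gradf_jm CF_bound f_var). Qed.

Let mG_sqr i y : X y -> dotv (mG i y) (mG i y) <= CG 0 i ^+ 2.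
Proof.
exact: (mean_grad_sqr cX (gi i) (gsub i) (gm i)
  (gradg_jm i) (CG_bound (i := i)) (g_var i)).
Qed.

Definition real_lagrangian (y : 'rV[R]_n) (u : 'rV[R]_m) : R :=
  F y + \sum_i u 0 i * G i y.
Local Notation L := real_lagrangian.

Lemma lagrangianE y u : X y ->
  lagrangian (mean mu f) (fun i => mean mu (g i)) y u = (L y u)%:E.
Proof.
move=> Xy; rewrite /lagrangian FE// EFinD -sumEFin; congr (_ + _)%E.
by apply: eq_bigr => i _; rewrite GE// EFinM.
Qed.

Let pstar := L xs zs.

Let L_saddle_dual u : orthant u -> L xs u <= pstar.
Proof.
move=> u0; have [_ _ sad] := saddle; have [] := sad xs u Xxs u0.
by rewrite !lagrangianE// lee_fin.
Qed.

Let L_saddle_primal y : X y -> pstar <= L y zs.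
Proof.
move=> Xy; have [_ _ sad] := saddle; have [_] := sad y zs Xy zs_ge0.
by rewrite !lagrangianE// lee_fin.
Qed.

Let L_sub y v (u : 'rV[R]_m) : orthant u -> X y -> X v ->
  L y u + dotv (mF y + \sum_i u 0 i *: mG i y) (v - y) <= L v u.
Proof.
move=> u0 Xy Xv; rewrite /real_lagrangian dotvDl addrACA lerD ?Fsub//.
rewrite dotv_suml -big_split; apply: ler_sum => i _ /=.
by rewrite dotvZl -mulrDr ler_wpM2l ?u0// Gsub.
Qed.

Local Notation hist j := (g_sigma_algebraType (past W j)).

(** The induction invariant. [hist k.*2] is generated by the samples preceding omega_k, exactly
    those on which x_k and z_k depend. *)
Record regular_iterate k : Prop := RegularIterate {
  st_X : forall t, X (x k t);
  st_z : forall t, orthant (z k t);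
  st_mx : measurable_fun setT (x k : hist k.*2 -> borelV R n);
  st_mz : forall i, measurable_fun setT ((fun t => z k t 0 i) : hist k.*2 -> R);
  st_ix : intg P (fun t => dotv (x k t - xs) (x k t - xs));
  st_iz : intg P (fun t => dotv (z k t) (z k t)) }.

Lemma regular_iterate1 : regular_iterate 1.
Proof.
have [start _] := iterates.
have xE : x 1%N = fun=> x1 by apply/funext => t; have [] := start t.
have zE : z 1%N = fun=> 0 by apply/funext => t; have [] := start t.
split; rewrite ?xE ?zE => //.
- by move=> t i; rewrite mxE.
- exact: intg_cst.
- exact: intg_cst.
Qed.

Let P2 := 8 * (4 * CF ^+ 2 + sigmaF ^+ 2) + 2 * \sum_i DG 0 i ^+ 2.
(** The coefficient of |z_k|^2 produced by Cauchy-Schwarz over the constraints; P3 is m times this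
    number. *)
Let bz := 8 * (4 * \sum_i CG 0 i ^+ 2 + \sum_i sigmaG 0 i ^+ 2).
Let x_dist k := \int[P]_t dotv (x k t - xs) (x k t - xs).
Let z_dist (u : 'rV[R]_m) k := \int[P]_t dotv (z k t - u) (z k t - u).
Let z_sqr k := \int[P]_t dotv (z k t) (z k t).
Let gap (u : 'rV[R]_m) k := \int[P]_t F (x k.+1 t)
  + \sum_i u 0 i * \int[P]_t G i (x k.+1 t) - pstar.

Lemma z_dist_intg k u : regular_iterate k ->
  intg P (fun t => dotv (z k t - u) (z k t - u)).
Proof.
move=> st.
apply: (intg_le _ _ (intgD (intgZ 2 (st_iz st)) (intg_cst P (2 * dotv u u)))).
  apply: measurable_dotv => i;
    under eq_fun do rewrite !mxE;
    by apply: measurable_funB => //; exact: hist_fun (st_mz st i).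
move=> t; rewrite ger0_norm ?dotv_ge0//.
by have := dotvD_le (z k t) (- u); rewrite dotvNl dotvNr opprK.
Qed.

(** * One iteration of the algorithm *)

Section step.
Variables (k : nat) (kK : (1 <= k <= K)%N) (st : regular_iterate k).
Let k2 : (2 <= k.*2)%N.
Proof. by case/andP: kK => k1 _; rewrite -[2%N]/(1.*2) leq_double. Qed.
Let k21 : (2 <= k.*2.+1)%N. Proof. exact: leqW. Qed.
Let c := gamma k.
Let c_gt0 : 0 < c. Proof. exact: gamma_gt0. Qed.
Let xk := x k.
Let zk := z k.
Let p := x k.+1.
Let v t := gradf (W k.*2 t) (xk t) +
  \sum_(i < m) zk t 0 i *: gradg i (W k.*2 t) (xk t).
Let gs t : 'rV[R]_m := \row_(i < m) g i (W k.*2.+1 t) (p t).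
Let eF := noise mu W gradf k.*2 xk.
Let eG i := noise mu W (gradg i) k.*2 xk.

Let Xx := st_X st.
Let zO := st_z st.
Let mx := st_mx st.
Let mz := st_mz st.
Let ix := st_ix st.
Let iz := st_iz st.

Let pmin t : is_argmin X (fun y => dotv (v t) (y - xk t)
  + (2 * c)^-1 * enorm (y - xk t) ^+ 2) (p t).
Proof. by have [_ /(_ k t kK)[]] := iterates. Qed.

Let zmax t : is_argmax (@orthant R m) (fun y => dotv (gs t) (y - zk t)
  - (2 * c)^-1 * enorm (y - zk t) ^+ 2) (z k.+1 t).
Proof. by have [_ /(_ k t kK)[]] := iterates. Qed.

Let Xp t : X (p t). Proof. by have [] := pmin t. Qed.

Let z'O t : orthant (z k.+1 t). Proof. by have [] := zmax t. Qed.

Let sampleW j : (2 <= j)%N -> measurable_fun setT (W j : hist j.+1 -> Om).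
Proof. by move=> j2; apply: hist_sample; rewrite j2 /=. Qed.

Let mx' : measurable_fun setT (xk : hist k.*2.+1 -> borelV R n).
Proof. exact: hist_fun_le (leqnSn _) mx. Qed.

Let mz' i : measurable_fun setT ((fun t => zk t 0 i) : hist k.*2.+1 -> R).
Proof. exact: hist_fun_le (leqnSn _) (mz i). Qed.

Let mv j : measurable_fun setT ((fun t => v t 0 j) : hist k.*2.+1 -> R).
Proof.
under eq_fun do rewrite mxE summxE.
apply: measurable_funD.
  by apply: (grad_coord_measurable cX gradf_jm (Y := xk) (S := hist k.*2.+1))
    => //; exact: sampleW.
apply: measurable_sum => i; under eq_fun do rewrite mxE.
apply: measurable_funM => //.
by apply: (grad_coord_measurable cX (gradg_jm i) (Y := xk) (S := hist k.*2.+1))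
  => //; exact: sampleW.
Qed.

(** As a projection, [p] is 1-Lipschitz in x_k - c v along pairs of outcomes, and this vector is
    measurable once omega_k joins the history. *)
Let mp : measurable_fun setT (p : hist k.*2.+1 -> borelV R n).
Proof.
have mu_ : measurable_fun setT
    ((fun t => xk t - c *: v t) : hist k.*2.+1 -> borelV R n).
  apply: borel_vector_measurable => j.
  have -> : (fun t => (xk t - c *: v t) 0 j) =
      (fun t => xk t 0 j - c * v t 0 j) by apply/funext => t; rewrite !mxE.
  apply: measurable_funB.
    exact: measurableT_comp (borel_coord_measurable j) mx'.
  by apply: measurable_funM => //; exact: mv.
apply: (borel_vector_lipschitz ler01 mu_) => t t'.
rewrite mul1r; exact: (prox_nonexpansive Xcomb c_gt0 (pmin t) (pmin t')).
Qed.

Let mW' : measurable_fun setT (W k.*2.+1 : hist k.*2.+2 -> Om).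
Proof. exact: sampleW. Qed.

Let mgs i : measurable_fun setT ((fun t => gs t 0 i) : hist k.*2.+2 -> R).
Proof.
under eq_fun do rewrite mxE.
apply: (jointly_measurable_comp (S := hist k.*2.+2) cX (gjm i)) => //.
exact: hist_fun_le (leqnSn _) mp.
Qed.

Let mz1 i : measurable_fun setT
  ((fun t => z k.+1 t 0 i) : hist k.+1.*2 -> R).
Proof.
rewrite doubleS.
have mu_ : measurable_fun setT
    ((fun t => zk t + c *: gs t) : hist k.*2.+2 -> borelV R m).
  apply: borel_vector_measurable => j; under eq_fun do rewrite mxE [X in _ +
    X]mxE.
  apply: measurable_funD.
    exact: hist_fun_le (leqnSn _) (mz' j).
  by apply: measurable_funM => //; exact: mgs.
have mz1 : measurable_fun setT (z k.+1 : hist k.*2.+2 -> borelV R m).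
  apply: (borel_vector_lipschitz ler01 mu_) => t t'.
  have := prox_nonexpansive (@orthant_convex R m) c_gt0
    (orthant_argmax_min (zmax t)) (orthant_argmax_min (zmax t')).
  by rewrite mul1r !scalerN !opprK.
exact: measurableT_comp (borel_coord_measurable i) mz1.
Qed.

Let toT (d1 : measure_display) (S : measurableType d1) j (Y : T -> S) :
  measurable_fun setT (Y : hist j -> S) -> measurable_fun setT Y.
Proof. exact: hist_fun. Qed.

Let mxk i : measurable_fun setT ((fun t => (xk t - xs) 0 i) : hist k.*2 -> R).
Proof.
have -> : (fun t => (xk t - xs) 0 i) = (fun t => xk t 0 i - xs 0 i).
  by apply/funext => t; rewrite !mxE.
apply: measurable_funB => //.
exact: measurableT_comp (borel_coord_measurable i) mx.
Qed.

Let q t := dotv (zk t) (zk t).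
Let q_ge0 t : 0 <= q t. Proof. exact: dotv_ge0. Qed.
Let mq : measurable_fun setT (q : hist k.*2 -> R).
Proof. exact: (measurable_dotv (S := hist k.*2)). Qed.

Let EB := \int[P]_t q t.

Let eF_sqr : intg P (fun t => dotv (eF t) (eF t)) /\
  \int[P]_t dotv (eF t) (eF t) <= sigmaF ^+ 2.
Proof.
have [] := @noise_sqr_le _ _ _ _ _ _ _ _ _ iidW _ _ _ cX gradf_jm f_var _ k2
  _ mx Xx (fun=> 1) (@measurable_cst _ _ _ _ _ _) (fun=> ler01) (intg_cst P 1).
rewrite Rintegral_prob_cst mulr1.
rewrite (_ : (fun t => 1 * _) = fun t => dotv (eF t) (eF t))//.
by apply/funext => t; rewrite mul1r.
Qed.

Let eG_sqr i : intg P (fun t => q t * dotv (eG i t) (eG i t)) /\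
  \int[P]_t (q t * dotv (eG i t) (eG i t)) <= sigmaG 0 i ^+ 2 * EB.
Proof.
exact: (noise_sqr_le iidW cX (gradg_jm i) (g_var i) k2 mx Xx mq q_ge0 iz).
Qed.

Let iz_sqr i : intg P (fun t => zk t 0 i ^+ 2).
Proof.
apply: (intg_le _ _ iz); first by apply: measurable_funX; exact: toT (mz i).
by move=> t; rewrite ger0_norm ?sqr_ge0// sqr_coord_le_dotv.
Qed.

Let eF_mean0 : hasE P (fun t => dotv (eF t) (xk t - xs)) 0.
Proof.
have := @noise_mean0 _ _ _ _ _ _ _ _ _ iidW _ _ _ cX gradf_jm f_var _ k2
  _ mx Xx (fun=> 1) (fun t => xk t - xs) (@measurable_cst _ _ _ _ _ _) mxk
  (intg_cst P (1 ^+ 2)) ix.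
by rewrite (_ : (fun t => 1 * _) = fun t => dotv (eF t) (xk t - xs))//;
  apply/funext => t; rewrite mul1r.
Qed.

Let eG_mean0 i : hasE P (fun t => zk t 0 i * dotv (eG i t) (xk t - xs)) 0.
Proof.
exact: (noise_mean0 iidW cX (gradg_jm i) (g_var i) k2 mx Xx
  (b := fun t => xk t - xs) (mz i) mxk (iz_sqr i) ix).
Qed.

Let SG := \sum_i CG 0 i ^+ 2.

Let vE t : v t - (mF (xk t) + \sum_i zk t 0 i *: mG i (xk t)) =
  eF t + \sum_i zk t 0 i *: eG i t.
Proof.
rewrite /v opprD addrACA; congr (_ + _).
by rewrite -sumrB; apply: eq_bigr => i _; rewrite -scalerBr.
Qed.

Let dist_sym (l : nat) (u w : 'rV[R]_l) : dotv (u - w) (u - w) = dotv (w - u)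
  (w - u).
Proof. by rewrite -[w - u]opprB dotvNl dotvNr opprK. Qed.

Let v_sqr t : dotv (v t) (v t) <= 4 * (CF ^+ 2 + q t * SG)
  + 4 * (dotv (eF t) (eF t) + \sum_i q t * dotv (eG i t) (eG i t)).
Proof.
rewrite -(subrK (mF (xk t) + \sum_i zk t 0 i *: mG i (xk t)) (v t)) vE.
apply: le_trans (dotvD_le _ _) _; rewrite -mulr_sumr.
have := lagrangian_vec_le (zk t) (mF_sqr (Xx t)) (fun i => mG_sqr i (Xx t)).
have := lagrangian_vec_le (zk t) (lexx (dotv (eF t) (eF t)))
  (fun i => lexx (dotv (eG i t) (eG i t))).
rewrite -/(q t) -/SG.
move: (\sum_i dotv (eG i t) _) (dotv (eF t) _) => ? ?.
move: (dotv (mF _ + _) _) (dotv (eF _ + _) _) => ? ? ? ?.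
by lra.
Qed.

Let iv_bound : intg P (fun t => 4 * (CF ^+ 2 + q t * SG)
  + 4 * (dotv (eF t) (eF t) + \sum_i q t * dotv (eG i t) (eG i t))).
Proof.
apply: intgD; apply: intgZ; apply: intgD.
- exact: intg_cst.
- by under eq_fun do rewrite mulrC; exact: intgZ.
- by have [] := eF_sqr.
- by apply: intg_sum => i; have [] := eG_sqr i.
Qed.

Let mp' : measurable_fun setT (p : T -> borelV R n).
Proof. exact: toT mp. Qed.

Let mdist_p : measurable_fun setT (fun t => dotv (p t - xs) (p t - xs)).
Proof.
have mpi i : measurable_fun setT (fun t => (p t - xs) 0 i).
  have -> : (fun t => (p t - xs) 0 i) = (fun t => p t 0 i - xs 0 i).
    by apply/funext => t; rewrite !mxE.
  apply: measurable_funB => //.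
  exact: measurableT_comp (borel_coord_measurable i) mp'.
exact: measurable_dotv.
Qed.

Let ip : intg P (fun t => dotv (p t - xs) (p t - xs)).
Proof.
apply: (intg_le _ _ (intgD (intgZ 2 ix) (intgZ (2 * c ^+ 2) iv_bound))) => //.
move=> t; rewrite ger0_norm ?dotv_ge0//.
(* [xs] is its own proximal step in direction 0, so nonexpansiveness bounds |p - xs|^2 by |x_k - xs
   - c v|^2. *)
have xsmin : is_argmin X (fun y => dotv 0 (y - xs) +
    (2 * c)^-1 * enorm (y - xs) ^+ 2) xs.
  split=> // y _; rewrite ![dotv 0 _]dotvC !dotv0r !add0r.
  rewrite ler_wpM2l ?invr_ge0 ?mulr_ge0 ?(ltW c_gt0)// !enorm_sqr subrr.
  by rewrite dotv0r dotv_ge0.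
have := prox_nonexpansive Xcomb c_gt0 (pmin t) xsmin.
rewrite scaler0 subr0 addrAC => h; apply: le_trans h _.
apply: le_trans (dotvD_le _ _) _; rewrite lerD2l -mulrA ler_pM2l//.
rewrite dotvNl dotvNr opprK dotvZl dotvZr mulrA -expr2.
by rewrite ler_wpM2l ?sqr_ge0// v_sqr.
Qed.

Let F_sqr : intg P (fun t => F (p t) ^+ 2).
Proof.
exact: (mean_comp_sqr_intg cX XD fi fsub fm gradf_jm CF_bound f_var mp' Xp Xxs
  ip).
Qed.

Let mF_p : measurable_fun setT (fun t => F (p t)).
Proof.
exact: (mean_comp_measurable cX XD fi fsub fm gradf_jm CF_bound f_var mp' Xp).
Qed.

Let G_sqr i : intg P (fun t => G i (p t) ^+ 2).
Proof.
exact: (mean_comp_sqr_intg cX XD (gi i) (gsub i) (gm i) (gradg_jm i)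
  (CG_bound (i := i)) (g_var i) mp' Xp Xxs ip).
Qed.

Let mG_p i : measurable_fun setT (fun t => G i (p t)).
Proof.
exact: (mean_comp_measurable cX XD (gi i) (gsub i) (gm i) (gradg_jm i)
  (CG_bound (i := i)) (g_var i) mp' Xp).
Qed.

Lemma F_iterate_intg : intg P (fun t => F (x k.+1 t)).
Proof. exact: intg_sqr mF_p F_sqr. Qed.

Lemma G_iterate_intg i : intg P (fun t => G i (x k.+1 t)).
Proof. exact: intg_sqr (mG_p i) (G_sqr i). Qed.

Let mgp i : measurable_fun setT
  (fun w : hist k.*2.+1 * Om => g i w.2 (p w.1)).
Proof.
apply: (jointly_measurable_comp cX (gjm i) (Y := fun w : hist k.*2.+1 * Om => p
  w.1)) => //.
exact: measurableT_comp mp measurable_fst.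
Qed.

Let gs_sqr i : intg P (fun t => gs t 0 i ^+ 2) /\
  \int[P]_t (gs t 0 i ^+ 2) <= DG 0 i ^+ 2.
Proof.
have [] := @freezing_le _ _ _ _ _ _ _ _ iidW _ k21
  (fun t w => g i w (p t) ^+ 2) (fun=> DG 0 i ^+ 2).
- by apply: measurable_funX; exact: mgp.
- by move=> t w; exact: sqr_ge0.
- move=> t; have := DG_bound i (Xp t); rewrite unlock.
  by under eq_integral do rewrite /= real_normK ?num_real//.
- exact: intg_cst.
rewrite Rintegral_prob_cst => igs gsD.
have gsE t : gs t 0 i ^+ 2 = g i (W k.*2.+1 t) (p t) ^+ 2 by rewrite mxE.
split; first by under eq_fun do rewrite gsE.
by under eq_Rintegral do rewrite gsE.
Qed.

Let mgsT i : measurable_fun setT (fun t => gs t 0 i).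
Proof. exact: toT (mgs i). Qed.

Let mzT i : measurable_fun setT (fun t => zk t 0 i).
Proof. exact: toT (mz i). Qed.

Let izG i : intg P (fun t => zk t 0 i * G i (p t)).
Proof. exact: intgM (iz_sqr i) (G_sqr i). Qed.

(** The dual sample is independent of [hist k.*2.+1], which determines both [p] and [zk]. The second
    integral is kept apart because it cancels against the z_k G(p) terms of the primal part. *)
Let gs_mean i (a : R) : hasE P (fun t => gs t 0 i * (a - zk t 0 i))
  (a * \int[P]_t G i (p t) - \int[P]_t (zk t 0 i * G i (p t))).
Proof.
have maz : measurable_fun setT (fun t => a - zk t 0 i).
  exact: measurable_funB.
have iaz : intg P (fun t => (a - zk t 0 i) ^+ 2).
  apply: (intg_le _ _ (intgD (intg_cst P (2 * a ^+ 2)) (intgZ 2 (iz_sqr i)))).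
    exact: measurable_funX.
  move=> t; rewrite ger0_norm ?sqr_ge0//.
  by have := sqr_ge0 (a + zk t 0 i); nra.
have igz : intg P (fun t => gs t 0 i * (a - zk t 0 i)).
  by apply: intgM => //; have [] := gs_sqr i.
split => //.
have gsE t : gs t 0 i * (a - zk t 0 i) =
  g i (W k.*2.+1 t) (p t) * (a - zk t 0 i) by rewrite mxE.
transitivity (\int[P]_t (g i (W k.*2.+1 t) (p t) * (a - zk t 0 i))).
  by apply: eq_Rintegral => t _; exact: gsE.
rewrite (@freezing_eq _ _ _ _ _ _ _ _ iidW _ k21
  (fun t w => g i w (p t) * (a - zk t 0 i))
  (fun t => a * G i (p t) - zk t 0 i * G i (p t))).
- rewrite RintegralB//; [|by apply: intgZ; exact: G_iterate_intg|exact: izG].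
  by rewrite RintegralZl//; exact: G_iterate_intg.
- apply: measurable_funM; first exact: mgp.
  apply: measurable_funB => //; exact: measurableT_comp (mz' i) measurable_fst.
- by move: igz; under eq_fun do rewrite gsE.
- move=> t; rewrite -mulrBl mulrC EFinM -GE//.
  under eq_integral do rewrite EFinM.
  rewrite integralZr//; last exact: gi.
  by rewrite /mean unlock.
Qed.

Let mz_next i : measurable_fun setT (fun t => z k.+1 t 0 i).
Proof. exact: toT (mz1 i). Qed.

Let iz1 : intg P (fun t => dotv (z k.+1 t) (z k.+1 t)).
Proof.
have igs : intg P (fun t => dotv (gs t) (gs t)).
  apply: intg_sum => i; have [] := gs_sqr i.
  by under eq_fun do rewrite expr2.
apply: (intg_le _ _ (intgD (intgZ 2 iz) (intgZ (2 * c ^+ 2) igs))).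
  exact: measurable_dotv.
move=> t; rewrite ger0_norm ?dotv_ge0//.
have zmin0 : is_argmin (@orthant R m) (fun y => dotv 0 (y - 0) +
    (2 * c)^-1 * enorm (y - 0) ^+ 2) 0.
  split=> [i|y _]; first by rewrite mxE.
  rewrite !subr0 (dotvC 0 y) !dotv0r !add0r.
  rewrite ler_wpM2l ?invr_ge0 ?mulr_ge0 ?(ltW c_gt0)// !enorm_sqr.
  by rewrite dotv0r dotv_ge0.
have := prox_nonexpansive (@orthant_convex R m) c_gt0
  (orthant_argmax_min (zmax t)) zmin0.
rewrite scaler0 !subr0 scalerN opprK => h; apply: le_trans h _.
apply: le_trans (dotvD_le _ _) _; rewrite lerD2l -mulrA ler_pM2l//.
by rewrite dotvZl dotvZr mulrA -expr2.
Qed.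

Lemma regular_iterate_next : regular_iterate k.+1.
Proof.
split => //.
exact: hist_fun_le (leqnSn _) mp.
Qed.

Section descent_path.
Variables (u : 'rV[R]_m) (u_ge0 : orthant u).

(** Primal gap at z_k plus the dual linear term; in expectation z_k cancels and 4 c times the gap at
    [u] remains. *)
Let lhs t := 4 * c * (F (p t) + \sum_i zk t 0 i * G i (p t) - pstar)
  + 4 * c * \sum_i gs t 0 i * (u 0 i - zk t 0 i).

(** The sum of the right-hand sides of [primal_step] and [dual_step]; 32 and 8 are 16 and 4 doubled
    by splitting the objective from the constraints in [lagrangian_vec_le]. *)
Let rhs t := 2 * dotv (xk t - xs) (xk t - xs) - 2 * dotv (p t - xs) (p t - xs)
  + (2 * dotv (zk t - u) (zk t - u) - 2 * dotv (z k.+1 t - u) (z k.+1 t - u))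
  + 32 * c ^+ 2 * (CF ^+ 2 + SG * q t)
  + 8 * c ^+ 2 * (dotv (eF t) (eF t) + \sum_i q t * dotv (eG i t) (eG i t))
  + 2 * c ^+ 2 * \sum_i gs t 0 i ^+ 2
  - 4 * c * (dotv (eF t) (xk t - xs)
             + \sum_i zk t 0 i * dotv (eG i t) (xk t - xs)).

Let lhs_le_rhs t : lhs t <= rhs t.
Proof.
have c4 : 0 <= 4 * c by rewrite mulr_ge0// ltW.
(* [zs] maximizes L(xs, .), so the random value L(xs, z_k) may be replaced by the constant
   [pstar]. *)
have gap_le := ler_wpM2l c4 (lerB (lexx (L (p t) (zk t))) (L_saddle_dual (zO
  t))).
have pr := primal_step (L := L ^~ (zk t)) Xcomb c_gt0 (pmin t) Xxs
  (L_sub (zO t) (Xx t) Xxs) (L_sub (zO t) (Xp t) (Xx t))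
  (lagrangian_vec_le (zk t) (mF_sqr (Xx t)) (fun i => mG_sqr i (Xx t)))
  (lagrangian_vec_le (zk t) (mF_sqr (Xp t)) (fun i => mG_sqr i (Xp t))).
have du := dual_step c_gt0 (zmax t) u_ge0.
have e2 := lagrangian_vec_le (zk t) (lexx (dotv (eF t) (eF t)))
  (fun i => lexx (dotv (eG i t) (eG i t))).
have c24 : 0 <= 4 * c ^+ 2 by rewrite mulr_ge0// sqr_ge0.
move: e2 => /(ler_wpM2l c24).
move: pr du; rewrite /lhs /rhs vE -/(q t) -/SG [q t * SG]mulrC -mulr_sumr.
rewrite (dist_sym xs (xk t)) (dist_sym xs (p t)) (dist_sym u).
rewrite (dist_sym u (z k.+1 t)) [dotv (eF t + _) (xk t - xs)]dotvDl dotv_suml.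
have -> : \sum_i dotv (zk t 0 i *: eG i t) (xk t - xs) =
    \sum_i zk t 0 i * dotv (eG i t) (xk t - xs).
  by apply: eq_bigr => i _; rewrite dotvZl.
have -> : dotv (gs t) (u - zk t) = \sum_i gs t 0 i * (u 0 i - zk t 0 i).
  by apply: eq_bigr => i _; congr (_ * _); rewrite !mxE.
have -> : dotv (gs t) (gs t) = \sum_i gs t 0 i ^+ 2.
  by apply: eq_bigr => i _; rewrite expr2.
move: gap_le; rewrite -[F (p t) + _]/(L (p t) (zk t)).
move: (L (p t) (zk t)) (L xs (zk t)) (\sum_i gs t 0 i * _)
  (\sum_i gs t 0 i ^+ 2) (\sum_i zk t 0 i * _) (\sum_i dotv (eG i t) _).
move: (dotv (eF t + _) _) (dotv (eF t) (eF t)) (dotv (eF t) _).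
move: (dotv (xk t - _) _) (dotv (p t - _) _) (dotv (zk t - u) _)
  (dotv (z k.+1 t - u) _) (q t) => *.
by lra.
Qed.

Let lhsE : hasE P lhs (4 * c * gap u k).
Proof.
have -> : 4 * c * gap u k = 4 * c * (\int[P]_t F (p t)
    + \sum_i \int[P]_t (zk t 0 i * G i (p t)) - pstar)
    + 4 * c * \sum_i (u 0 i * \int[P]_t G i (p t)
                      - \int[P]_t (zk t 0 i * G i (p t))).
  rewrite sumrB /gap; move: (\sum_i \int[P]_t _) (\sum_i _) (\int[P]_t _).
  by move=> *; ring.
apply: hasED; apply: hasEZ.
  apply: hasEB; last exact: hasE_cst.
  apply: hasED; first by apply: intg_hasE; exact: F_iterate_intg.
  by apply: hasE_sum => i; exact: intg_hasE.
by apply: hasE_sum => i; exact: gs_mean.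
Qed.

Let st' := regular_iterate_next.

Let rhsE : hasE P rhs (2 * x_dist k - 2 * x_dist k.+1
  + (2 * z_dist u k - 2 * z_dist u k.+1) + 32 * c ^+ 2 * (CF ^+ 2 + SG * EB)
  + 8 * c ^+ 2 * (\int[P]_t dotv (eF t) (eF t)
     + \sum_i \int[P]_t (q t * dotv (eG i t) (eG i t)))
  + 2 * c ^+ 2 * \sum_i \int[P]_t (gs t 0 i ^+ 2)
  - 4 * c * (0 + \sum_(i < m) 0)).
Proof.
apply: hasEB; last first.
  apply: hasEZ; apply: hasED; first exact: eF_mean0.
  by apply: hasE_sum => i; exact: eG_mean0.
apply: hasED; last first.
  by apply: hasEZ; apply: hasE_sum => i; apply: intg_hasE; have [] := gs_sqr i.
apply: hasED; last first.
  apply: hasEZ; apply: hasED; first by apply: intg_hasE; have [] := eF_sqr.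
  by apply: hasE_sum => i; apply: intg_hasE; have [] := eG_sqr i.
apply: hasED; last first.
  apply: hasEZ; apply: hasED; first exact: hasE_cst.
  by apply: hasEZ; exact: intg_hasE.
apply: hasED; apply: hasEB; apply: hasEZ; apply: intg_hasE => //.
- exact: z_dist_intg.
- exact: z_dist_intg.
Qed.

Lemma step_descent : 4 * gamma k * gap u k <=
  2 * (x_dist k + z_dist u k) - 2 * (x_dist k.+1 + z_dist u k.+1)
  + gamma k ^+ 2 * (P2 + bz * z_sqr k).
Proof.
have := hasE_le lhsE rhsE lhs_le_rhs.
rewrite [X in 0 + X]big1// addr0 mulr0 subr0 => le1.
apply: le_trans le1 _.
have c2 : 0 <= c ^+ 2 by exact: sqr_ge0.
have /(ler_wpM2l c2) : \int[P]_t dotv (eF t) (eF t)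
    + \sum_i \int[P]_t (q t * dotv (eG i t) (eG i t)) <=
    sigmaF ^+ 2 + (\sum_i sigmaG 0 i ^+ 2) * EB.
  rewrite mulr_suml lerD//; first by have [] := eF_sqr.
  by apply: ler_sum => i _; have [] := eG_sqr i.
have /(ler_wpM2l c2) : \sum_i \int[P]_t (gs t 0 i ^+ 2) <= \sum_i DG 0 i ^+ 2.
  by apply: ler_sum => i _; have [] := gs_sqr i.
rewrite /P2 /bz -/SG -[z_sqr k]/EB -/c.
move: (\sum_i \int[P]_t (gs t 0 i ^+ 2)) (\sum_i \int[P]_t (q t * _)).
move: (\int[P]_t dotv (eF t) (eF t)) (\sum_i DG 0 i ^+ 2) (\sum_i sigmaG 0 i ^+
  2).
move: (x_dist k) (x_dist k.+1) (z_dist u k) (z_dist u k.+1) SG EB => *.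
by lra.
Qed.

End descent_path.
End step.

Lemma iterates_regular k : (1 <= k <= K.+1)%N -> regular_iterate k.
Proof.
elim: k => // -[_ _|k IH /= kK]; first exact: regular_iterate1.
by apply: regular_iterate_next => //; apply: IH; rewrite /= ltnW.
Qed.

(** * Bounds at the averaged iterate *)

Section bounds.
Variables (P1 P3 : R).
Let S1 := \sum_(1 <= k < K.+1) gamma k.
Let S2 := \sum_(1 <= k < K.+1) gamma k ^+ 2.
Hypotheses (K_gt0 : (0 < K)%N)
  (P1_bound : 2 * dotv (x1 - xs) (x1 - xs)
     + 4 * dotv (const_mx 1 + zs) (const_mx 1 + zs) <= P1)
  (P3_bound : bz <= P3) (P3S2 : P3 * S2 < 1).
Let M := (P1 + P2 * S2) / (1 - P3 * S2).

Let kS k : (1 <= k <= K)%N -> (1 <= k <= K.+1)%N.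
Proof. by move=> /andP[-> /leqW]. Qed.

Let st k : (1 <= k <= K)%N -> regular_iterate k.
Proof. by move=> kK; apply: iterates_regular; exact: kS. Qed.

Let EF k : (1 <= k <= K)%N -> intg P (fun t => F (x k.+1 t)).
Proof. by move=> kK; apply: F_iterate_intg => //; exact: st. Qed.

Let EG i k : (1 <= k <= K)%N -> intg P (fun t => G i (x k.+1 t)).
Proof. by move=> kK; apply: G_iterate_intg => //; exact: st. Qed.

Let Xnext k t : (1 <= k <= K)%N -> X (x k.+1 t).
Proof. by move=> /andP[_ kK]; apply: st_X; apply: iterates_regular. Qed.

Let x_dist1 : x_dist 1 = dotv (x1 - xs) (x1 - xs).
Proof.
rewrite /x_dist -[RHS](Rintegral_prob_cst P); apply: eq_Rintegral => t _.
by have [/(_ t)[-> _] _] := iterates.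
Qed.

Let z_dist1 u : z_dist u 1 = dotv u u.
Proof.
rewrite /z_dist -[RHS](Rintegral_prob_cst P); apply: eq_Rintegral => t _.
by have [/(_ t)[_ ->] _] := iterates; rewrite sub0r dotvNl dotvNr opprK.
Qed.

Let a u k := x_dist k + z_dist u k.

Let descent_u u : orthant u -> descent K gamma z_sqr P2 bz (gap u) (a u).
Proof. by move=> u0 k kK; apply: step_descent => //; exact: st. Qed.

Let a_ge0 u k : 0 <= a u k.
Proof.
by rewrite addr_ge0// Rintegral_ge0// => t _; exact: dotv_ge0.
Qed.

Let P1_ge0 : 0 <= P1.
Proof. by apply: le_trans P1_bound; rewrite addr_ge0// mulr_ge0 ?dotv_ge0. Qed.

Let P2_ge0 : 0 <= P2.
Proof.
have D0 : 0 <= \sum_i DG 0 i ^+ 2 by apply: sumr_ge0 => i _; exact: sqr_ge0.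
by rewrite /P2; have := sqr_ge0 CF; have := sqr_ge0 sigmaF; lra.
Qed.

Let bz_ge0 : 0 <= bz.
Proof.
rewrite mulr_ge0// addr_ge0 ?mulr_ge0//; apply: sumr_ge0 => i _;
  exact: sqr_ge0.
Qed.

Let orthant_sqr_le (u w : 'rV[R]_m) : orthant u -> (forall i, u 0 i <= w 0 i) ->
  dotv u u <= dotv w w.
Proof. by move=> u0 uw; apply: ler_sum => i _; rewrite ler_pM. Qed.

(** Origin of 4|1 + zs|^2 in P1: as z_1 = 0, twice the initial distance contains 2|u|^2, and for u =
    zs the second-moment bound adds 2|zs|^2. The multipliers 0, zs and zs + e_i all lie below 1 +
    zs. *)
Let a1_bound u : orthant u -> (forall i, u 0 i <= 1 + zs 0 i) ->
  2 * a u 1%N + 2 * dotv u u <= P1.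
Proof.
move=> u0 uzs; apply: le_trans P1_bound; rewrite /a x_dist1 z_dist1.
have : dotv u u <= dotv (const_mx 1 + zs) (const_mx 1 + zs).
  by apply: orthant_sqr_le => // i; rewrite !mxE.
by move: (dotv (const_mx 1 + zs) _) (dotv u u) => *; lra.
Qed.

Let gapE u k : (1 <= k <= K)%N ->
  hasE P (fun t => L (x k.+1 t) u - pstar) (gap u k).
Proof.
move=> kK; apply: hasEB; last exact: hasE_cst.
apply: hasED; first exact/intg_hasE/EF.
by apply: hasE_sum => i; apply/hasEZ/intg_hasE/EG.
Qed.

Let gap_zs_ge0 k : (1 <= k <= K)%N -> 0 <= gap zs k.
Proof.
move=> kK; apply: hasE_le (hasE_cst P 0) (gapE zs kK) _ => t.
by rewrite subr_ge0 L_saddle_primal//; exact: Xnext.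
Qed.

Let z_sqr_le_M k : (1 <= k <= K)%N -> z_sqr k <= M.
Proof.
apply: (second_moment_bound gamma_gt0 P1_ge0 P2_ge0 bz_ge0 P3_bound P3S2
  (descent_u zs_ge0) gap_zs_ge0 (c := 2 * dotv zs zs)).
- move=> {}k kK; rewrite /a.
  have zE := intg_hasE (st_iz (st kK)).
  have dE := intg_hasE (z_dist_intg zs (st kK)).
  have xd : 0 <= x_dist k by rewrite Rintegral_ge0// => t _; exact: dotv_ge0.
  have := hasE_le zE (hasED (hasEZ 2 dE) (hasE_cst P (2 * dotv zs zs))).
  rewrite -/(z_sqr k) -/(z_dist zs k) => h.
  apply: le_trans (h _) _; last by rewrite mulrDr; lra.
  by move=> t; have := dotvD_le (z k t - zs) zs; rewrite subrK.
- by apply: a1_bound => // i; rewrite lerDr.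
Qed.

Let gap_sum_le u : orthant u -> (forall i, u 0 i <= 1 + zs 0 i) ->
  4 * \sum_(1 <= k < K.+1) gamma k * gap u k <= M.
Proof.
move=> u0 uzs.
apply: (descent_bound P1_ge0 P2_ge0 bz_ge0 P3_bound P3S2 (descent_u u0)) => //.
have := a1_bound u0 uzs; have := dotv_ge0 u.
by move: (a u 1%N) (dotv u u) => *; lra.
Qed.

Let S1_gt0 : 0 < S1. Proof. exact: sum_weights_gt0. Qed.

Local Notation xbar := (averaged_iterate gamma K x).

Let Xbar t : X (xbar t).
Proof. by apply: convex_average => // k kK; exact: Xnext. Qed.

Let mx_next k : (1 <= k <= K)%N ->
  measurable_fun setT (x k.+1 : T -> borelV R n).
Proof.
move=> /andP[_ kK]; have st1 : regular_iterate k.+1 by apply: iterates_regular;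
  rewrite /=.
exact: hist_fun (st_mx st1).
Qed.

Let mxbar : measurable_fun setT (xbar : T -> borelV R n).
Proof.
apply: borel_vector_measurable => j.
have -> : (fun t => xbar t 0 j) = (fun t => S1^-1 *
    \sum_(1 <= k < K.+1) gamma k * x k.+1 t 0 j).
  apply/funext => t; rewrite mxE summxE; congr (_ * _).
  by apply: eq_bigr => k _; rewrite mxE.
apply: measurable_funM => //.
(* Indexing by ordinals keeps every summand within the range where the iterates are known to be
   measurable. *)
have -> : (fun t => \sum_(1 <= k < K.+1) gamma k * x k.+1 t 0 j) =
    (fun t => \sum_(k < K) gamma k.+1 * x k.+2 t 0 j).
  by apply/funext => t; rewrite big_add1 big_mkord.
apply: measurable_sum => k; apply: measurable_funM => //.
apply: measurableT_comp (borel_coord_measurable j) _.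
by apply: (mx_next (k := k.+1)); rewrite /= ltn_ord.
Qed.

Let hasE_avg (h : nat -> T -> R) :
  (forall k, (1 <= k <= K)%N -> intg P (h k)) ->
  hasE P (fun t => S1^-1 * \sum_(1 <= k < K.+1) gamma k * h k t)
    (S1^-1 * \sum_(1 <= k < K.+1) gamma k * \int[P]_t h k t).
Proof.
move=> ih; apply: hasEZ; rewrite big_add1 big_mkord.
have -> : (fun t => \sum_(1 <= k < K.+1) gamma k * h k t) =
    (fun t => \sum_(k < K) gamma k.+1 * h k.+1 t).
  by apply/funext => t; rewrite big_add1 big_mkord.
apply: hasE_sum => k; apply/hasEZ/intg_hasE/ih.
by rewrite /= ltn_ord.
Qed.

Let ixbar : intg P (fun t => dotv (xbar t - xs) (xbar t - xs)).
Proof.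
have idist k : (1 <= k <= K)%N ->
    intg P (fun t => dotv (x k.+1 t - xs) (x k.+1 t - xs)).
  by move=> /andP[_ kK]; apply: st_ix; apply: iterates_regular.
apply: (intg_le _ _ (proj1 (hasE_avg idist))).
  have mb i : measurable_fun setT (fun t => (xbar t - xs) 0 i).
    have -> : (fun t => (xbar t - xs) 0 i) = (fun t => xbar t 0 i - xs 0 i).
      by apply/funext => t; rewrite mxE [X in _ + X]mxE.
    apply: measurable_funB => //.
    exact: measurableT_comp (borel_coord_measurable i) mxbar.
  exact: measurable_dotv.
move=> t; rewrite ger0_norm ?dotv_ge0//.
apply: (jensen_subgradient (y := fun k => x k.+1 t) K_gt0 gamma_gt0
  (h := fun y => dotv (y - xs) (y - xs)) (s := 2 *: (xbar t - xs))) => k _.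
exact: sqr_dist_subgradient.
Qed.

Let F_avg : intg P (fun t => F (xbar t)) /\
  \int[P]_t F (xbar t) <=
    S1^-1 * \sum_(1 <= k < K.+1) gamma k * \int[P]_t F (x k.+1 t).
Proof.
have mFb := mean_comp_measurable cX XD fi fsub fm gradf_jm CF_bound f_var
  mxbar Xbar.
have iF2 := mean_comp_sqr_intg cX XD fi fsub fm gradf_jm CF_bound f_var
  mxbar Xbar Xxs ixbar.
have iF := intg_sqr mFb iF2; split => //.
apply: hasE_le (intg_hasE iF) (hasE_avg (fun k => @EF k)) _ => t.
apply: (jensen_subgradient (y := fun k => x k.+1 t) K_gt0 gamma_gt0
  (s := mF (xbar t))) => k kK.
by apply: Fsub; [exact: Xbar|exact: Xnext].
Qed.

Let G_avg i : intg P (fun t => G i (xbar t)) /\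
  \int[P]_t G i (xbar t) <=
    S1^-1 * \sum_(1 <= k < K.+1) gamma k * \int[P]_t G i (x k.+1 t).
Proof.
have mGb := mean_comp_measurable cX XD (gi i) (gsub i) (gm i) (gradg_jm i)
  (CG_bound (i := i)) (g_var i) mxbar Xbar.
have iG2 := mean_comp_sqr_intg cX XD (gi i) (gsub i) (gm i) (gradg_jm i)
  (CG_bound (i := i)) (g_var i) mxbar Xbar Xxs ixbar.
have iG := intg_sqr mGb iG2; split => //.
apply: hasE_le (intg_hasE iG) (hasE_avg (fun k => @EG i k)) _ => t.
apply: (jensen_subgradient (y := fun k => x k.+1 t) K_gt0 gamma_gt0
  (s := mG i (xbar t))) => k kK.
by apply: Gsub; [exact: Xbar|exact: Xnext].
Qed.

Let avg_le (e : nat -> R) (r : R) :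
  4 * \sum_(1 <= k < K.+1) gamma k * (e k - r) <= M ->
  S1^-1 * (\sum_(1 <= k < K.+1) gamma k * e k) - r <= (4 * S1)^-1 * M.
Proof.
have -> : \sum_(1 <= k < K.+1) gamma k * (e k - r) =
    \sum_(1 <= k < K.+1) gamma k * e k - S1 * r.
  by rewrite /S1 mulr_suml -sumrB; apply: eq_bigr => k _; rewrite mulrBr.
move=> h; rewrite -(ler_pM2l (_ : 0 < 4 * S1)) ?mulr_gt0// mulrA mulfV; last
  first.
  by rewrite gt_eqF// mulr_gt0.
rewrite mul1r (le_trans _ h)// mulrBr mulrA -(mulrA 4) mulfV ?gt_eqF// mulr1.
by rewrite mulrBr mulrA.
Qed.

(** Weak duality: at a feasible y the term zs . G(y) is nonpositive, so pstar <= L(y, zs) <= F(y).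
    The optimal value is subtracted in the conclusion, which calls for this direction. *)
Lemma optimal_value_ge : (pstar%:E <=
  optimal_value X (mean mu f) (fun i => mean mu (g i)))%E.
Proof.
apply: le_ereal_inf_tmp => _ [y [Xy Gy] <-]; rewrite FE// lee_fin.
apply: le_trans (L_saddle_primal Xy) _.
rewrite -[leRHS]addr0 lerD2l; apply: sumr_le0 => i _.
rewrite mulr_ge0_le0//.
by have := Gy i; rewrite GE// lee_fin.
Qed.

Lemma primal_dual_bounds : expected_bounds P X (mean mu f)
  (fun i => mean mu (g i)) xbar ((4 * S1)^-1 * M).
Proof.
have intF : (fun t => mean mu f (xbar t)) = EFin \o (fun t => F (xbar t)).
  by apply/funext => t; rewrite FE.
have intG i : (fun t => mean mu (g i) (xbar t)) =
    EFin \o (fun t => G i (xbar t)).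
  by apply/funext => t; rewrite GE.
split; [|move=> i]; rewrite ?intF ?intG; split.
- by have [] := F_avg.
- have [iF leF] := F_avg; rewrite intg_Rintegral//.
  apply: (@le_trans _ _ ((\int[P]_t F (xbar t))%:E - pstar%:E)%E).
    by apply: leeB => //; exact: optimal_value_ge.
  rewrite -EFinB lee_fin; apply: le_trans (lerB leF (lexx _)) _.
  have gap0 k : gap 0 k = \int[P]_t F (x k.+1 t) - pstar.
    by rewrite /gap big1 ?addr0// => i _; rewrite mxE mul0r.
  apply: avg_le; under eq_bigr do rewrite -gap0.
  by apply: gap_sum_le => i; rewrite mxE// addr_ge0.
- by have [] := G_avg i.
- have [iG leG] := G_avg i; rewrite intg_Rintegral// lee_fin.
  apply: le_trans leG _; rewrite -[leLHS]subr0; apply: avg_le.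
  (* The gap at this [u] exceeds the gap at [zs] by exactly E[G^i(x_{k+1})], and the gap at [zs] is
     nonnegative. *)
  pose u : 'rV[R]_m := zs + delta_mx 0 i.
  have u0 : orthant u.
    by move=> j; rewrite !mxE addr_ge0// zs_ge0.
  apply: le_trans (gap_sum_le u0 _); last first.
    by move=> j; rewrite !mxE addrC lerD2r; case: (_ && _).
  rewrite ler_pM2l// big_nat_cond [leRHS]big_nat_cond; apply: ler_sum => k.
  rewrite andbT ltnS => kK; rewrite ler_wpM2l ?subr0//; first by rewrite ltW//
    gamma_gt0.
  have := gap_zs_ge0 kK; rewrite /gap.
  have -> : \sum_j u 0 j * \int[P]_t G j (x k.+1 t) =
      \sum_j zs 0 j * \int[P]_t G j (x k.+1 t) + \int[P]_t G i (x k.+1 t).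
    under eq_bigr do rewrite !mxE mulrDl.
    rewrite big_split/=; congr (_ + _).
    rewrite (bigD1 i)//= eqxx mul1r big1 ?addr0// => j /negbTE ->.
    by rewrite mul0r.
  by move: (\sum_j _) (\int[P]_t _) => *; lra.
Qed.

End bounds.
End PrimalDual.

Theorem theorem2p2 (R : realType) (n m : nat)
    (* random data *)
    (d : measure_display) (Om : measurableType d) (mu : probability Om R)
    (X dom : set 'rV[R]_n)
    (f : Om -> 'rV[R]_n -> R) (g : 'I_m -> Om -> 'rV[R]_n -> R)
    (gradf : Om -> 'rV[R]_n -> 'rV[R]_n)
    (gradg : 'I_m -> Om -> 'rV[R]_n -> 'rV[R]_n)
    (CF sigmaF : R) (CG sigmaG DG : 'rV[R]_m)
    (* samples and iterates *)
    (d' : measure_display) (T : measurableType d') (P : probability T R)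
    (W : nat -> {RV P >-> Om})
    (gamma : nat -> R) (K : nat) (x1 : 'rV[R]_n)
    (x : nat -> T -> 'rV[R]_n) (z : nat -> T -> 'rV[R]_m)
    (xs : 'rV[R]_n) (zs : 'rV[R]_m) :
  let F := mean mu f in
  let G := fun i => mean mu (g i) in
  let P1 := 2 * enorm (x1 - xs) ^+ 2 + 4 * enorm (const_mx 1 + zs) ^+ 2 in
  let P2 := 8 * (4 * CF ^+ 2 + sigmaF ^+ 2) + 2 * enorm DG ^+ 2 in
  let P3 := 8 * m%:R * (4 * enorm CG ^+ 2 + enorm sigmaG ^+ 2) in
  let xbar := averaged_iterate gamma K x in
  let sum1 := \sum_(1 <= k < K.+1) gamma k in
  let sum2 := \sum_(1 <= k < K.+1) gamma k ^+ 2 in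
  (* setting *)
  closed X -> convex_set X -> X `<=` dom ->
  (forall w, convex_function X (f w)) ->
  (forall i w, convex_function X (g i w)) ->
  (forall y, X y -> mu.-integrable setT (fun w => (f w y)%:E)) ->
  (forall i y, X y -> mu.-integrable setT (fun w => (g i w y)%:E)) ->
  (forall w y, X y ->
    subdifferential dom (fun v => (f w v)%:E) y (gradf w y)) ->
  (forall i w y, X y ->
    subdifferential dom (fun v => (g i w v)%:E) y (gradg i w y)) ->
  (* measurability *)
  (forall y, dom y -> measurable_fun setT (fun w => f w y)) ->
  (forall i y, dom y -> measurable_fun setT (fun w => g i w y)) ->
  (forall i, jointly_measurable X (g i)) ->
  jointly_measurable X (gradf : Om -> 'rV[R]_n -> borelV R n) ->
  (forall i, jointly_measurable X (gradg i : Om -> 'rV[R]_n -> borelV R n)) ->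
  (* (a) *)
  (forall y s, X y -> subdifferential dom F y s -> enorm s <= CF) ->
  (forall i y s, X y -> subdifferential dom (G i) y s ->
     enorm s <= CG 0 i) ->
  (* (b) *)
  (forall y, X y ->
     (variance_vec mu (fun w => gradf w y) <= (sigmaF ^+ 2)%:E)%E) ->
  (forall i y, X y ->
     (variance_vec mu (fun w => gradg i w y) <= (sigmaG 0 i ^+ 2)%:E)%E) ->
  (* (c) *)
  (forall i y, X y ->
     ('E_mu[fun w => (`|g i w y| ^+ 2)%R] <= (DG 0 i ^+ 2)%:E)%E) ->
  (* (d) *)
  saddle_point X F G xs zs ->
  (* algorithm *)
  (0 < K)%N ->
  (forall k, (1 <= k <= K)%N -> 0 < gamma k) ->
  X x1 ->
  iid_on mu [set j | (2 <= j)%N] W ->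
  primal_dual_iterates X g gradf gradg gamma K W x1 x z ->
  (P3 * sum2 < 1 ->
     expected_bounds P X F G xbar
       ((4 * sum1)^-1 * ((P1 + P2 * sum2) / (1 - P3 * sum2)))) /\
  (* the extended-real inverse makes P3^(-1/2) equal to +oo when P3 = 0 *)
  (forall gam : R, 0 < gam -> (gam%:E < (Num.sqrt P3)%:E^-1)%E ->
     (forall k, (1 <= k <= K)%N -> gamma k = gam / Num.sqrt K%:R) ->
     let eta := (P1 + P2 * gam ^+ 2) / (4 * gam * (1 - P3 * gam ^+ 2)) in
     expected_bounds P X F G xbar (eta / Num.sqrt K%:R)).
Proof.
move=> F G P1 P2 P3 xbar sum1 sum2 cX convX XD _ _ fi gi fsub gsub fm gm gjm.
move=> gradf_jm gradg_jm CF_bound CG_bound f_var g_var DG_bound saddle K_gt0.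
move=> gamma_gt0 Xx1 iidW iterates.
have enormE (u : 'rV[R]_m) : enorm u ^+ 2 = \sum_i u 0 i ^+ 2.
  by rewrite enorm_sqr; apply: eq_bigr => i _; rewrite expr2.
have sqr_sum_ge0 (u : 'rV[R]_m) : 0 <= \sum_i u 0 i ^+ 2.
  by apply: sumr_ge0 => i _; exact: sqr_ge0.
have P3_bound : 8 * (4 * \sum_i CG 0 i ^+ 2 + \sum_i sigmaG 0 i ^+ 2) <= P3.
  rewrite /P3 !enormE.
  (* Without constraints all sums over ['I_m] vanish; otherwise the factor m is at least 1. *)
  have [m0|m_gt0] := posnP m.
    have empty (i : 'I_m) : False by have := ltn_ord i; rewrite {2}m0.
    by rewrite !big1 ?mulr0 ?addr0 ?mulr0// => i; case: (empty i).
  rewrite ler_wpM2r ?addr_ge0 ?mulr_ge0//.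
  by rewrite ler_peMr// ler1n.
have P3_ge0 : 0 <= P3.
  apply: le_trans P3_bound; apply: mulr_ge0 => //; apply: addr_ge0 => //.
  exact: mulr_ge0.
have main : P3 * sum2 < 1 -> expected_bounds P X F G xbar
    ((4 * sum1)^-1 * ((P1 + P2 * sum2) / (1 - P3 * sum2))).
  move=> P3sum2; rewrite /P2 enormE.
  apply: (primal_dual_bounds cX convX XD fi gi fsub gsub fm gm gjm gradf_jm
    gradg_jm CF_bound CG_bound f_var g_var DG_bound saddle gamma_gt0 Xx1 iidW
    iterates K_gt0 _ P3_bound P3sum2).
  by rewrite /P1 !enorm_sqr.
split=> // gam gam_gt0 gam_lt gammaE eta.
have K0 : 0 < K%:R :> R by rewrite ltr0n.
have sK0 : 0 < Num.sqrt K%:R :> R by rewrite sqrtr_gt0.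
have sKK : Num.sqrt K%:R ^+ 2 = K%:R :> R by rewrite sqr_sqrtr// ltW.
(* Knowing only s > 0 and s^2 = K leaves rational identities: [sum1] is K gam / s = gam s and [sum2]
   is gam^2. *)
move: gammaE sK0 sKK; move: (Num.sqrt K%:R) => s gammaE s_gt0 sKK.
have sum1E : sum1 = gam * s.
  rewrite /sum1 (eq_big_nat _ _ (F2 := fun=> gam / s)) => [|k kK].
    rewrite sumr_const_nat subSS subn0 -mulr_natr -sKK.
    by field; rewrite gt_eqF.
  exact: gammaE.
have sum2E : sum2 = gam ^+ 2.
  rewrite /sum2 (eq_big_nat _ _ (F2 := fun=> (gam / s) ^+ 2)).
    rewrite sumr_const_nat subSS subn0 -mulr_natr -sKK.
    by field; rewrite gt_eqF.
  by move=> k kK; rewrite gammaE.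
have P3gam : P3 * gam ^+ 2 < 1.
  have [->|P3_neq0] := eqVneq P3 0; first by rewrite mul0r.
  have P3_gt0 : 0 < P3 by rewrite lt0r P3_neq0.
  have s0 : 0 < Num.sqrt P3 by rewrite sqrtr_gt0.
  move: gam_lt; rewrite inver gt_eqF// lte_fin.
  rewrite -[X in _ < X]mul1r ltr_pdivlMr// => h.
  rewrite -(sqr_sqrtr P3_ge0) -exprMn mulrC expr_lt1//.
  by rewrite mulr_ge0// ltW.
rewrite (_ : eta / _ = (4 * sum1)^-1 * ((P1 + P2 * sum2) / (1 - P3 * sum2))).
  by apply: main; rewrite sum2E.
rewrite sum1E sum2E /eta; field.
by rewrite !gt_eqF// subr_gt0.
Qed.
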